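(* Let either $r_1,r_2\in\{\frac12,\frac13,\frac14,\frac16\}$ or $(r_1,r_2)\in\{(\frac15,\frac25),(\frac18,\frac38),(\frac1{10},\frac3{10}),(\frac1{12},\frac5{12})\}$, let $d$ be the least common denominator of $r_1,r_2$, and let $\mu=r_1(1-r_1)+r_2(1-r_2)$. Put $$c(k;q)=\frac{(q^{dr_1};q^d)_k\,(q^{d(1-r_1)};q^d)_k\,(q^{dr_2};q^d)_k\,(q^{d(1-r_2)};q^d)_k}{(q^d;q^d)_k^4}\,q^{dk},\qquad H(N;q)=\sum_{k=0}^{N-1}c(k;q).$$ Then for all positive integers $A,B,n$ with $\gcd(n,d)=1$ and $n>1$, $$\frac{H(An;q)}{H(Bn;q)}\equiv\frac{H(A;q^n)}{H(B;q^n)}+C(A,B)\,(n^2-1)(q^n-1)^2\pmod{\Phi_n(q)^3},$$ where $$C(A,B)=d^2\,\frac{H(A;1)\sum_{\ell=0}^{B-1}\ell(\ell+\mu)c(\ell;1)-H(B;1)\sum_{\ell=0}^{A-1}\ell(\ell+\mu)c(\ell;1)}{12\,H(B;1)^2}.$$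
   Context: Notation: $(a;q)_k=(1-a)(1-aq)\cdots(1-aq^{k-1})$ is the $q$-Pochhammer symbol, and $\Phi_n(q)$ is the $n$th cyclotomic polynomial. $c(k;q)$ and $H(N;q)$ are rational functions of $q$; $c(k;1)$ and $H(N;1)$ denote their limits as $q\to1$, so $c(k;1)=\frac{(r_1)_k(1-r_1)_k(r_2)_k(1-r_2)_k}{k!^4}$ with $(a)_k=a(a+1)\cdots(a+k-1)$, and $H(N;1)=\sum_{k=0}^{N-1}c(k;1)$. Congruences between rational functions: for polynomials $A_1(q),A_2(q),P(q)\in\mathbb Z[q]$, $A_1(q)/A_2(q)\equiv0\pmod{P(q)}$ means that $P(q)$ divides $A_1(q)$ and is coprime with $A_2(q)$; for rational functions $A(q),B(q)\in\mathbb Z(q)$, $A(q)\equiv B(q)\pmod{P(q)}$ means $A(q)-B(q)\equiv0\pmod{P(q)}$. *)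

(* Defs.v *)
From mathcomp Require Import all_boot all_order all_algebra all_field.
From mathcomp Require Import ring.

Set Implicit Arguments.
Unset Strict Implicit.
Unset Printing Implicit Defensive.

Import Order.TTheory GRing.Theory Num.Theory.
Local Open Scope ring_scope.

(* Z(q), as the fraction field of Z[q]; [qvar] is the indeterminate q. *)
Notation ratfun := {fraction {poly int}}.
Notation "p %:F" := (@FracField.tofrac {poly int} p) : ring_scope.
Definition qvar : ratfun := 'X%:F.

(* Divisibility is exact divisibility in Z[q], because [%|] over the
   non-field int is only divisibility up to a nonzero integer factor.
   [coprimep] (no nonconstant common factor) agrees with coprimality in the
   UFD Z[q] as soon as P is primitive, e.g. for powers of 'Phi_n. *)
Definition congr0 (P : {poly int}) (f : ratfun) : Prop :=
  exists A1 A2 : {poly int},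
    [/\ A2 != 0, f = A1%:F / A2%:F,
        exists S : {poly int}, A1 = S * P & coprimep P A2].

Definition congr_mod (P : {poly int}) (f g : ratfun) : Prop :=
  congr0 P (f - g).

Definition admissible (r1 r2 : rat) : bool :=
  let s : seq rat := [:: 1 / 2; 1 / 3; 1 / 4; 1 / 6] in
  (r1 \in s) && (r2 \in s)
  || ((r1, r2) \in [:: (1 / 5, 2 / 5); (1 / 8, 3 / 8);
                       (1 / 10, 3 / 10); (1 / 12, 5 / 12)]).

Definition lcd (r1 r2 : rat) : nat := lcmn `|denq r1| `|denq r2|.

(* The product d * r as a natural number; meaningful only when r >= 0 and the
   denominator of r divides d, as in all uses below. *)
Definition natmulq (d : nat) (r : rat) : nat := `|numq (d%:R * r)|%N.

Definition qpoch (F : fieldType) (a x : F) (k : nat) : F :=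
  \prod_(i < k) (1 - a * x ^+ i).

(* [c r1 r2 k x] and [H r1 r2 N x] are c(k;x) and H(N;x), so that substituting
   q^n for q is taking x := q^n. They do not give the values at 1: the
   quotients would be 0 / 0 there. *)
Definition c (r1 r2 : rat) (F : fieldType) (k : nat) (x : F) : F :=
  let d := lcd r1 r2 in
  qpoch (x ^+ natmulq d r1) (x ^+ d) k
  * qpoch (x ^+ natmulq d (1 - r1)) (x ^+ d) k
  * qpoch (x ^+ natmulq d r2) (x ^+ d) k
  * qpoch (x ^+ natmulq d (1 - r2)) (x ^+ d) k
  / qpoch (x ^+ d) (x ^+ d) k ^+ 4 * x ^+ (d * k).

Definition H (r1 r2 : rat) (F : fieldType) (N : nat) (x : F) : F :=
  \sum_(k < N) c r1 r2 k x.

Definition poch (a : rat) (k : nat) : rat := \prod_(i < k) (a + i%:R).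

(* c(k;1) and H(N;1), the limits as q -> 1; see [c_at1] and [H_at1]. *)
Definition c1 (r1 r2 : rat) (k : nat) : rat :=
  poch r1 k * poch (1 - r1) k * poch r2 k * poch (1 - r2) k / k`!%:R ^+ 4.

Definition H1 (r1 r2 : rat) (N : nat) : rat := \sum_(k < N) c1 r1 r2 k.

Definition mu (r1 r2 : rat) : rat := r1 * (1 - r1) + r2 * (1 - r2).

Definition W1 (r1 r2 : rat) (N : nat) : rat :=
  \sum_(l < N) l%:R * (l%:R + mu r1 r2) * c1 r1 r2 l.

Definition C (r1 r2 : rat) (A B : nat) : rat :=
  (lcd r1 r2)%:R ^+ 2
  * (H1 r1 r2 A * W1 r1 r2 B - H1 r1 r2 B * W1 r1 r2 A)
  / (12 * H1 r1 r2 B ^+ 2).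

(* The rational function f has no pole at q = 1, and its value there (hence its
   limit as q -> 1) is v. *)
Definition value_at1 (f : ratfun) (v : rat) : Prop :=
  exists a b : {poly int},
    [/\ b.[1] != 0, f = a%:F / b%:F & v = a.[1]%:~R / b.[1]%:~R].

Lemma value_at1D f g u v :
  value_at1 f u -> value_at1 g v -> value_at1 (f + g) (u + v).
Proof.
move=> [a [b [b1 -> ->]]] [a' [b' [b'1 -> ->]]].
have nz (p : {poly int}) : p.[1] != 0 -> p%:F != 0.
  by rewrite tofrac_eq0; apply: contraNneq => ->; rewrite horner0.
exists (a * b' + a' * b), (b * b'); split; first by rewrite hornerM mulf_neq0.
  by rewrite addf_div ?nz // -!tofracM -tofracD.
rewrite !(hornerD, hornerM) rmorphD !rmorphM /= addf_div ?intr_eq0 //.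
Qed.

Lemma admissible_itv r1 r2 :
  admissible r1 r2 -> [/\ 0 <= r1 <= 1 & 0 <= r2 <= 1].
Proof.
rewrite /admissible => /orP[/andP[]|]; rewrite !inE.
  by do 2![move=> /or4P[] /eqP ->].
by move=> /or4P[] /eqP[-> ->].
Qed.

Lemma natmulqE (d : nat) (r : rat) :
  0 <= r -> (`|denq r| %| d)%N -> (natmulq d r)%:R = d%:R * r :> rat.
Proof.
move=> r0 /dvdnP[e ->]; rewrite /natmulq natrM -mulrA.
have -> : `|denq r|%:R * r = (numq r)%:~R.
  by rewrite mulrC pmulrn absz_denq numqE.
have -> : e%:R * (numq r)%:~R = (e%:Z * numq r)%:~R :> rat by rewrite intrM.
by rewrite numq_int pmulrn gez0_abs // mulr_ge0 // numq_ge0.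
Qed.

Lemma natmulq1BE (d : nat) (r : rat) : 0 <= r <= 1 -> (`|denq r| %| d)%N ->
  (natmulq d (1 - r))%:R = d%:R * (1 - r) :> rat.
Proof.
move=> /andP[r0 r1] dr.
have E : d%:R * (1 - r) = (d - natmulq d r)%:R :> rat.
  rewrite natrB; first by rewrite natmulqE // mulrBr mulr1.
  by rewrite -(ler_nat rat) natmulqE // ler_piMr // ler0n.
by rewrite E /natmulq E; move: (d - _)%N => m; rewrite [m%:R]pmulrn numq_int.
Qed.

(* 1 + q + ... + q^(m-1) *)
Definition qint (m : nat) : {poly int} := \sum_(i < m) 'X^i.

Lemma qint1 m : (qint m).[1] = m%:R.
Proof.
rewrite horner_sum (eq_bigr (fun=> 1)) ?sumr_const ?card_ord // => i _.
by rewrite hornerXn expr1n.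
Qed.

Lemma qpoch_qvar m d k :
  qpoch (qvar ^+ m) (qvar ^+ d) k
  = ((1 - 'X) ^+ k * \prod_(i < k) qint (m + d * i))%:F.
Proof.
have -> : (1 - 'X : {poly int}) ^+ k = \prod_(i < k) (1 - 'X).
  by rewrite prodr_const card_ord.
rewrite -big_split /= rmorph_prod; apply: eq_bigr => i _.
rewrite -exprM -exprD /qvar -tofracXn -tofrac1 -tofracB; congr (_%:F).
by rewrite -{1}(expr1n _ (m + d * i)) subrXX; congr (_ * _);
   apply: eq_bigr => j _; rewrite expr1n mul1r.
Qed.

Lemma prod_qint1 (d m k : nat) (r : rat) : m%:R = d%:R * r ->
  ((\prod_(i < k) qint (m + d * i)).[1])%:~R = d%:R ^+ k * poch r k :> rat.
Proof.
move=> E; rewrite horner_prod rmorph_prod /= /poch.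
have -> : d%:R ^+ k = \prod_(i < k) d%:R :> rat.
  by rewrite prodr_const card_ord.
rewrite -big_split /=; apply: eq_bigr => i _.
by rewrite qint1 rmorph_nat natrD natrM E mulrDr.
Qed.

Lemma cancel_common (F : fieldType) (x y a b e f g : F) : x != 0 -> g != 0 ->
  (x * a) * (x * b) * (x * e) * (x * f) / (x * g) ^+ 4 * y
  = a * b * e * f * y / g ^+ 4.
Proof. by move=> x0 g0; field; rewrite x0 g0. Qed.

Lemma c_at1 r1 r2 k :
  admissible r1 r2 -> value_at1 (c r1 r2 k qvar) (c1 r1 r2 k).
Proof.
move=> /admissible_itv[/andP[r1_0 r1_1] /andP[r2_0 r2_1]].
rewrite /c /=; set d := lcd r1 r2.
have d1 : (`|denq r1| %| d)%N by apply: dvdn_lcml.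
have d2 : (`|denq r2| %| d)%N by apply: dvdn_lcmr.
have d0 : (d%:R : rat) != 0.
  by rewrite pnatr_eq0 -lt0n lcmn_gt0 !absz_gt0 !denq_neq0.
pose Q m := \prod_(i < k) qint (m + d * i).
have QE m r : m%:R = d%:R * r -> (Q m).[1]%:~R = d%:R ^+ k * poch r k :> rat.
  exact: prod_qint1.
have Qd : (Q d).[1]%:~R = d%:R ^+ k * k`!%:R :> rat.
  rewrite (QE _ 1) ?mulr1 //; congr (_ * _).
  rewrite /poch fact_prod big_add1 /= big_mkord natr_prod.
  by apply: eq_bigr => i _; rewrite -natr1 addrC.
have Qd0 : (Q d).[1] != 0.
  by rewrite -(intr_eq0 rat) Qd mulf_neq0 ?expf_neq0 // pnatr_eq0 -lt0n fact_gt0.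
have X0 : (1 - 'X : {poly int})%:F != 0.
  by rewrite tofrac_eq0 -opprB oppr_eq0 polyXsubC_eq0.
have QF : (Q d)%:F != 0.
  by rewrite tofrac_eq0; apply: contraNneq Qd0 => ->; rewrite horner0.
exists (Q (natmulq d r1) * Q (natmulq d (1 - r1)) * Q (natmulq d r2)
        * Q (natmulq d (1 - r2)) * 'X^(d * k)), (Q d ^+ 4).
split; first by rewrite horner_exp expf_neq0.
- rewrite !qpoch_qvar /qvar -!/(Q _) [(Q d ^+ 4)%:F]tofracXn !tofracM.
  rewrite [('X^(d * k))%:F]tofracXn.
  by apply: cancel_common QF; rewrite tofracXn expf_neq0.
- rewrite horner_exp rmorphXn /= Qd !hornerM hornerXn expr1n mulr1 !rmorphM /=.
  rewrite (QE _ r1) ?natmulqE // (QE _ (1 - r1)) ?natmulq1BE ?r1_0 //.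
  rewrite (QE _ r2) ?natmulqE // (QE _ (1 - r2)) ?natmulq1BE ?r2_0 //.
  have f0 : (k`!%:R : rat) != 0 by rewrite pnatr_eq0 -lt0n fact_gt0.
  have dk0 : (d%:R : rat) ^+ k != 0 by rewrite expf_neq0.
  rewrite /c1; move: (d%:R ^+ k) dk0 (k`!%:R) f0 => x x0 f f0.
  by field; rewrite x0 f0.
Qed.

Lemma H_at1 r1 r2 N :
  admissible r1 r2 -> value_at1 (H r1 r2 N qvar) (H1 r1 r2 N).
Proof.
move=> adm; rewrite /H /H1.
elim/big_ind2: _ => [|f u g v|k _].
- by exists 0, 1; split; rewrite ?hornerE ?oner_eq0 ?tofrac0 ?mul0r.
- exact: value_at1D.
- exact: c_at1.
Qed.

(* Main.v *)
(* Write Q = q^d, a = d r1, a + d m = n a' with m < n, x = Q^(n l), E = q^(n a'), and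
   define b = d r2, m', b', E' in the same way. Work in the localization of the field
   of rational functions in q at a primitive n-th root of unity z, up to order 3.

   The block of the c(k;q) with l n <= k < (l + 1) n is c(l;q^n), for the parameters
   a', b', times an explicit product over the preceding rows, times a sum
   g(x, E, E', Q) over j < n of values at x Q^j of a rational function. Two identities
   control g. When Q is replaced by the root of unity Q0 = z^d, averaging over the
   n-th roots of unity gives
     g(x, E, E', Q0) = K x^(n-1) / ([n]_(xE) [n]_(xE')),  [n]_w = 1 + w + ... + w^(n-1).
   For arbitrary Q, the residue theorem gives g(1, 1, 1/x, Q) = g(x, 1, 1/x, Q).
   The mixed third difference of g with respect to x, (E, E') and Q has order 3, so
   that g(x, E, E', Q) - g(1, E, E', Q) can be computed at Q0. Hence, with t = q^n - 1,
     block l = block 0 * c(l;q^n)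
                 * (1 - (n^2-1)/12 t^2 (d^2 l^2 + l (a'(d-a') + b'(d-b')))).
   Admissibility of (r1, r2) means that {a', d-a', b', d-b'} = {a, d-a, b, d-b} as
   multisets, so c(l;q^n) is the original one, and block 0 cancels from the quotient.
   It is a unit: if z^d = exp (2 pi i / n), then all its terms are nonnegative at
   q = z, the first one being 1. *)
Require Import Defs.
From mathcomp Require Import all_boot all_order all_algebra all_field.
From mathcomp Require Import ring zify.

Set Implicit Arguments.
Unset Strict Implicit.
Unset Printing Implicit Defensive.

Import Order.TTheory GRing.Theory Num.Theory.
Local Open Scope ring_scope.

(** * Adic filtrations and mixed differences *)

(** The averaging identity is available only at Q0, and Q - Q0 has order 1, whereas g(x) - g(1) is
    needed to order 3. Passing from Q to Q0 in that difference gains only order 2. The missing order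
    comes from the residue identity: at (E, E') = (1, 1/x) the difference in x vanishes for Q and
    for Q0 alike, so moving (E, E') away from there is a third small step. Mixed differences on a
    cube replace a Taylor expansion in several variables: they are compatible with sums, products
    and inverses of units, and no derivatives occur. The constant 1/12 comes from the second-order
    coefficient (n^2 - 1)/12 of [n]_w^2 / (n^2 w^(n-1)) at w = 1; it enters through the completed
    rows and through the ratio of values of g. The order is measured at one root z only. This
    suffices because the primitive n-th roots of unity are conjugate, and it leaves z free to be
    chosen so that block 0 is a unit. The estimates are made for an abstract filtration [adic],
    where [I 0] is a local ring and [I 1] its set of nonunits; it is instantiated by
    [localization]. *)

Record adic (F : fieldType) := Adic {
  adic_ideal :> nat -> F -> Prop;
  adic0 : forall k, adic_ideal k 0;
  adic1 : adic_ideal 0%N 1;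
  adicD : forall k f g, adic_ideal k f -> adic_ideal k g -> adic_ideal k (f + g);
  adicN : forall k f, adic_ideal k f -> adic_ideal k (- f);
  adicM : forall k l f g, adic_ideal k f -> adic_ideal l g -> adic_ideal (k + l) (f * g);
  adicW : forall k f, adic_ideal k.+1 f -> adic_ideal k f;
  adicV : forall f, adic_ideal 0%N f -> ~ adic_ideal 1%N f -> adic_ideal 0%N f^-1;
  adic1N1 : ~ adic_ideal 1%N 1
}.

Section Adic.
Variables (F : fieldType) (I : adic F).
Implicit Types k l : nat.

Lemma adicB k f g : I k f -> I k g -> I k (f - g).
Proof. by move=> hf hg; apply: adicD => //; apply: adicN. Qed.

Lemma adicBC k f g : I k (f - g) -> I k (g - f).
Proof. by move=> /adicN; rewrite opprB. Qed.

Lemma adicB_trans k g f h : I k (f - g) -> I k (g - h) -> I k (f - h).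
Proof. by move=> fg /(adicD fg); rewrite addrA subrK. Qed.

Lemma adicWn k l f : (l <= k)%N -> I k f -> I l f.
Proof.
move=> /subnK <-; elim: (k - l)%N => // m IH /adicW; exact: IH.
Qed.

Lemma adicMl k f g : I 0%N f -> I k g -> I k (f * g).
Proof. by move=> hf hg; have := adicM hf hg. Qed.

Lemma adicMr k f g : I k f -> I 0%N g -> I k (f * g).
Proof. by move=> hf hg; rewrite mulrC; apply: adicMl. Qed.

Lemma adic_sum k (T : Type) (r : seq T) (P : pred T) (G : T -> F) :
  (forall i, P i -> I k (G i)) -> I k (\sum_(i <- r | P i) G i).
Proof. by move=> h; apply: (big_ind (I k)) => //; [apply: adic0|apply: adicD]. Qed.

Lemma adic_prod (T : Type) (r : seq T) (P : pred T) (G : T -> F) :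
  (forall i, P i -> I 0%N (G i)) -> I 0%N (\prod_(i <- r | P i) G i).
Proof. by move=> h; apply: (big_ind (I 0%N)) => //; [apply: adic1|apply: adicMl]. Qed.

Lemma adicX f m : I 0%N f -> I 0%N (f ^+ m).
Proof. by move=> h; elim: m => [|m IH]; rewrite ?exprS; [apply: adic1|apply: adicMl]. Qed.

Lemma adicXn f m : I 1%N f -> I m (f ^+ m).
Proof. by move=> h; elim: m => [|m IH]; rewrite ?exprS; [apply: adic1|apply: (adicM h IH)]. Qed.

Lemma adic_nat m : I 0%N m%:R.
Proof. by elim: m => [|m IH]; [exact: adic0 | rewrite -natr1; exact: adicD IH (adic1 I)]. Qed.

Lemma adicBM k f f' g g' : I 0%N f' -> I 0%N g ->
  I k (f - f') -> I k (g - g') -> I k (f * g - f' * g').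
Proof.
move=> f0 g0 hf hg; have -> : f * g - f' * g' = (f - f') * g + f' * (g - g') by ring.
by apply: adicD; [apply: adicMr|apply: adicMl].
Qed.

Lemma adicBsum k (T : Type) (r : seq T) (P : pred T) (G G' : T -> F) :
  (forall i, P i -> I k (G i - G' i)) ->
  I k (\sum_(i <- r | P i) G i - \sum_(i <- r | P i) G' i).
Proof. by move=> h; rewrite -sumrB; apply: adic_sum. Qed.

Lemma adicBprod k (T : Type) (r : seq T) (P : pred T) (G G' : T -> F) :
  (forall i, P i -> I 0%N (G i)) -> (forall i, P i -> I k (G i - G' i)) ->
  I k (\prod_(i <- r | P i) G i - \prod_(i <- r | P i) G' i).
Proof.
move=> h0 h.
have h0' i : P i -> I 0%N (G' i).
  move=> Pi; have := adicB (h0 i Pi) (adicWn (leq0n k) (h i Pi)).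
  by rewrite opprB addrC subrK.
elim: r => [|i r IH]; first by rewrite !big_nil subrr; apply: adic0.
rewrite !big_cons; case: ifP => // Pi.
apply: (adicBM (h0' i Pi) _ (h i Pi) IH); exact: adic_prod.
Qed.

Lemma adicBX k f f' m : I 0%N f -> I k (f - f') -> I k (f ^+ m - f' ^+ m).
Proof.
move=> f0 h; rewrite -[m]card_ord -!prodr_const; exact: adicBprod.
Qed.

Definition iunit u := I 0%N u /\ ~ I 1%N u.

Lemma iunit_neq0 u : iunit u -> u != 0.
Proof. by case=> _ h; apply/eqP => u0; apply: h; rewrite u0; apply: adic0. Qed.

Lemma iunit1 : iunit 1.
Proof. by split; [apply: adic1|apply: adic1N1]. Qed.

Lemma iunitP u : I 0%N u -> I 0%N u^-1 -> u != 0 -> iunit u.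
Proof.
move=> h0 hv u0; split=> // /(adicMl hv); rewrite mulVf //; exact: adic1N1.
Qed.

Lemma iunitV u : iunit u -> iunit u^-1.
Proof.
move=> hu; have [h0 h1] := hu; apply: iunitP; rewrite ?invrK ?invr_eq0 ?iunit_neq0 //.
exact: adicV.
Qed.

Lemma adic0V u : iunit u -> I 0%N u^-1.
Proof. by move=> [h0 h1]; apply: adicV. Qed.

Lemma iunitM u v : iunit u -> iunit v -> iunit (u * v).
Proof.
move=> hu hv; apply: iunitP; rewrite ?mulf_neq0 ?iunit_neq0 //.
  by apply: adicMl; [case: hu|case: hv].
by rewrite invfM; apply: adicMl; apply: adic0V.
Qed.

Lemma iunitMl u v : I 0%N u -> I 0%N v -> iunit (u * v) -> iunit u.
Proof. by move=> u0 v0 [_ h]; split=> // u1; apply: h; apply: adicMr. Qed.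

Lemma iunit_prod (T : Type) (r : seq T) (P : pred T) (G : T -> F) :
  (forall i, P i -> iunit (G i)) -> iunit (\prod_(i <- r | P i) G i).
Proof. by move=> h; apply: (big_ind iunit) => //; [apply: iunit1|apply: iunitM]. Qed.

Lemma iunitX u m : iunit u -> iunit (u ^+ m).
Proof. by move=> h; elim: m => [|m IH]; rewrite ?exprS; [apply: iunit1|apply: iunitM]. Qed.

Lemma iunit_close u v : iunit u -> I 1%N (v - u) -> iunit v.
Proof.
move=> [u0 u1] h; split.
  by rewrite -(subrK u v); apply: adicD => //; apply: adicW.
move=> v1; apply: u1; have -> : u = v - (v - u) by ring.
exact: adicB.
Qed.

Lemma adicBV k u v : iunit u -> iunit v -> I k (u - v) -> I k (u^-1 - v^-1).
Proof.
move=> hu hv h.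
have -> : u^-1 - v^-1 = (v - u) * (u^-1 * v^-1).
  by field; rewrite !iunit_neq0.
apply: adicMr; first exact: adicBC.
by apply: adicMl; apply: adic0V.
Qed.

Fixpoint cube s : Type := if s is s'.+1 then (bool * cube s')%type else unit.

(* A function on the vertices of a cube lies in the k-th step of the filtration
   when its r-fold mixed differences all lie in the ideal of order k + r. *)
Fixpoint cubic s k : (cube s -> F) -> Prop :=
  match s return (cube s -> F) -> Prop with
  | 0 => fun f => I k (f tt)
  | s'.+1 => fun f => (forall a, cubic k (fun t => f (a, t)))
                      /\ cubic k.+1 (fun t => f (true, t) - f (false, t))
  end.

Lemma cubic_ext s k (f g : cube s -> F) : f =1 g -> cubic k f -> cubic k g.
Proof.
elim: s k f g => [|s IH] k f g fg /=; first by rewrite fg.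
move=> [h1 h2]; split=> [a|]; first exact: IH (h1 a).
by apply: IH h2 => t; rewrite !fg.
Qed.

Lemma cubicD s k (f g : cube s -> F) :
  cubic k f -> cubic k g -> cubic k (fun t => f t + g t).
Proof.
elim: s k f g => [|s IH] k f g /=; first exact: adicD.
move=> [f1 f2] [g1 g2]; split=> [a|]; first exact: IH.
by apply: cubic_ext (IH _ _ _ f2 g2) => t /=; ring.
Qed.

Lemma cubicN s k (f : cube s -> F) : cubic k f -> cubic k (fun t => - f t).
Proof.
elim: s k f => [|s IH] k f /=; first exact: adicN.
move=> [f1 f2]; split=> [a|]; first exact: IH.
by apply: cubic_ext (IH _ _ f2) => t /=; ring.
Qed.

(** Discrete Leibniz rule: the difference of f g is (difference of f) * g(true) + f(false) *
    (difference of g), and each term gains the order of one difference. *)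
Lemma cubicM s k l (f g : cube s -> F) :
  cubic k f -> cubic l g -> cubic (k + l) (fun t => f t * g t).
Proof.
elim: s k l f g => [|s IH] k l f g /=; first exact: adicM.
move=> [f1 f2] [g1 g2]; split=> [a|]; first exact: IH.
have h1 := IH _ _ _ _ f2 (g1 true); have h2 := IH _ _ _ _ (f1 false) g2.
rewrite addnS in h2; rewrite addSn in h1.
by apply: cubic_ext (cubicD h1 h2) => t /=; ring.
Qed.

Lemma cubic0 s k : cubic k (fun _ : cube s => 0).
Proof.
elim: s k => [|s IH] k /=; first exact: adic0.
by split=> [a|]; [apply: IH| apply: cubic_ext (IH _) => t; rewrite subrr].
Qed.

Lemma cubicC s k c : I k c -> cubic k (fun _ : cube s => c).
Proof.
move=> h; elim: s => [|s IH] //=; split=> [a|] //.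
by apply: cubic_ext (cubic0 _ _) => t; rewrite subrr.
Qed.

Lemma cubicW s k (f : cube s -> F) : cubic k.+1 f -> cubic k f.
Proof.
elim: s k f => [|s IH] k f /=; first exact: adicW.
by move=> [f1 f2]; split=> [a|]; apply: IH.
Qed.

Lemma cubicV s (f : cube s -> F) :
  cubic 0 f -> (forall t, ~ I 1%N (f t)) -> cubic 0 (fun t => (f t)^-1).
Proof.
elim: s f => [|s IH] f /=; first by move=> f0 f1; apply: adicV.
move=> [f1 f2] fn; split=> [a|]; first by apply: IH.
have h1 := IH _ (f1 true) (fun t => fn _); have h2 := IH _ (f1 false) (fun t => fn _).
apply: cubic_ext (cubicN (cubicM (cubicM h1 h2) f2)) => t /=.
have nz b : f (b, t) != 0.
  by apply/eqP => e; apply: (fn (b, t)); rewrite e; apply: adic0.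
by field; rewrite !nz.
Qed.

Lemma cubic_lift s k (f : cube s -> F) : cubic k f ->
  cubic (s := s.+1) k (fun t => (f t.2)).
Proof.
move=> h; split=> [a|] //.
by apply: cubic_ext (cubic0 _ _) => t; rewrite subrr.
Qed.

(** A coordinate of the cube switches a quantity between two values. Mixed differences involving any
    other coordinate vanish. *)
Lemma cubic_toggle s u v : I 0%N u -> I 0%N v -> I 1%N (u - v) ->
  cubic (s := s.+1) 0 (fun t => if t.1 then u else v).
Proof. by move=> hu hv h; split=> [[]|] /=; apply: cubicC. Qed.

Lemma cubic_sum s k (T : Type) (r : seq T) (P : pred T) (G : T -> cube s -> F) :
  (forall i, P i -> cubic k (G i)) ->
  cubic k (fun t => \sum_(i <- r | P i) G i t).
Proof.
move=> h; elim: r => [|i r IH].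
  by apply: cubic_ext (cubic0 _ _) => t; rewrite big_nil.
case: (boolP (P i)) => Pi.
  by apply: cubic_ext (cubicD (h i Pi) IH) => t; rewrite big_cons Pi.
by apply: cubic_ext IH => t; rewrite big_cons (negbTE Pi).
Qed.

Lemma cubic_prod s (T : Type) (r : seq T) (P : pred T) (G : T -> cube s -> F) :
  (forall i, P i -> cubic 0 (G i)) ->
  cubic 0 (fun t => \prod_(i <- r | P i) G i t).
Proof.
move=> h; elim: r => [|i r IH].
  by apply: cubic_ext (cubicC _ (adic1 I)) => t; rewrite big_nil.
case: (boolP (P i)) => Pi.
  by apply: cubic_ext (cubicM (h i Pi) IH) => t; rewrite big_cons Pi.
by apply: cubic_ext IH => t; rewrite big_cons (negbTE Pi).
Qed.

Lemma cubicX s m (f : cube s -> F) : cubic 0 f -> cubic 0 (fun t => f t ^+ m).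
Proof.
move=> h; elim: m => [|m IH]; first by apply: cubic_ext (cubicC _ (adic1 I)).
by apply: cubic_ext (cubicM h IH) => t; rewrite exprS.
Qed.

End Adic.

(** * Residues and averages over roots of unity *)

Section Residues.
Variables (F : fieldType) (I : finType) (z : I -> F).
Hypothesis z_inj : injective z.

(** By Lagrange interpolation the sum is the coefficient of degree [#|I|.-1] of p, which is 0. *)
Lemma lagrange_residue (p : {poly F}) : (size p < #|I|)%N ->
  \sum_k p.[z k] / \prod_(i | i != k) (z k - z i) = 0.
Proof.
move=> szp; pose D k := \prod_(i | i != k) (z k - z i).
pose Lk k : {poly F} := \prod_(i | i != k) ('X - (z i)%:P).
have D0 k : D k != 0.
  by apply/prodf_neq0 => i; rewrite subr_eq0 eq_sym (inj_eq z_inj).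
have szL k : size (Lk k) = #|I|.
  rewrite /Lk -big_filter size_prod_XsubC.
  have := cardC1 k; rewrite cardE /enum_mem => e; rewrite size_filter.
  have I0 : (0 < #|I|)%N by apply/card_gt0P; exists k.
  rewrite -[in RHS](prednK I0) -[in RHS](cardC1 k) cardE /enum_mem size_filter.
  by congr (_.+1).
have LE k l : (Lk k).[z l] = if k == l then D k else 0.
  rewrite /Lk horner_prod; case: eqVneq => [<-|kl].
    by apply: eq_bigr => i _; rewrite hornerXsubC.
  by rewrite (bigD1 l) ?[l == k]eq_sym //= hornerXsubC subrr mul0r.
pose L := \sum_k (p.[z k] / D k) *: Lk k.
have szLs : (size L <= #|I|)%N.
  apply: leq_trans (size_sum _ _ _) _; apply/bigmax_leqP => k _.
  by rewrite (leq_trans (size_scale_leq _ _)) ?szL.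
have pL : p = L.
  apply/eqP; rewrite -subr_eq0; apply/eqP.
  apply: (@roots_geq_poly_eq0 _ _ [seq z i | i <- enum I]).
  - apply/allP => _ /mapP[i _ ->]; rewrite /root hornerD hornerN horner_sum.
    rewrite (bigD1 i) //= big1 ?addr0 => [|k ki]; last first.
      by rewrite hornerZ LE (negbTE ki) mulr0.
    by rewrite hornerZ LE eqxx divfK ?D0 ?subrr.
  - by rewrite map_inj_uniq ?enum_uniq.
  - rewrite size_map -cardE (leq_trans (size_polyD _ _)) // size_polyN.
    by rewrite geq_max szLs ltnW.
have := congr1 (fun q : {poly F} => q`_(#|I|.-1)) pL.
rewrite nth_default; last by rewrite -ltnS (leq_trans szp) // leqSpred.
rewrite coef_sum => e; rewrite [RHS]e; apply: eq_bigr => k _.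
rewrite coefZ; suff -> : (Lk k)`_(#|I|.-1) = 1 by rewrite mulr1.
have : lead_coef (Lk k) = 1 by apply/monicP; apply: monic_prod_XsubC.
by rewrite lead_coefE szL.
Qed.

(* Up to sign, the summands are the residues of [p z / \prod_i (1 - z / z i)]. *)
Lemma residue_sum0 (p : {poly F}) : (forall i, z i != 0) -> (size p < #|I|)%N ->
  \sum_k z k * p.[z k] / \prod_(i | i != k) (1 - z k / z i) = 0.
Proof.
move=> z0 szp; have := lagrange_residue szp.
move=> /(congr1 (fun s => (- 1) ^+ #|I|.-1 * (\prod_i z i) * s)).
rewrite mulr0 big_distrr => {2}<-; apply: eq_bigr => k _ /=.
have -> : \prod_(i | i != k) (1 - z k / z i) =
  (- 1) ^+ #|I|.-1 * (\prod_(i | i != k) (z k - z i)) / \prod_(i | i != k) z i.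
  rewrite -(cardC1 k) -prodr_const -big_split -prodf_div /=; apply: eq_bigr => i _.
  by field.
rewrite [\prod_i z i](bigD1 k) //=.
have D0 : \prod_(i | i != k) (z k - z i) != 0.
  by apply/prodf_neq0 => i; rewrite subr_eq0 eq_sym (inj_eq z_inj).
have Z0 : \prod_(i | i != k) z i != 0 by apply/prodf_neq0 => i _.
have S0 : (-1 : F) ^+ #|I|.-1 != 0 by rewrite signr_eq0.
have S2 : ((-1 : F) ^+ #|I|.-1) ^+ 2 = 1 by rewrite sqrr_sign.
move: D0 Z0 S0 S2; set D := \prod_(i | _) (_ - _); set Z := \prod_(i | _) _.
set S := _ ^+ #|I|.-1 => D0 Z0 S0 S2.
rewrite -[LHS]mul1r -{1}S2; field.
by rewrite D0 Z0 S0.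
Qed.

End Residues.

Definition qn (F : fieldType) (n : nat) (w : F) : F := \sum_(i < n) w ^+ i.

Lemma qnE (F : fieldType) n (w : F) : (1 - w) * qn n w = 1 - w ^+ n.
Proof. by rewrite -[RHS]opprB subrX1 -mulNr opprB. Qed.

Section PrimitiveRoot.
Variables (F : fieldType) (n : nat) (Q : F).
Hypothesis Qprim : n.-primitive_root Q.

Let Q0 : Q != 0.
Proof.
apply/eqP => e; have := prim_expr_order Qprim; rewrite e expr0n.
by have := prim_order_gt0 Qprim; case: n => // k _ /eqP; rewrite eq_sym oner_eq0.
Qed.

Lemma prod_prim (w : F) : \prod_(i < n) (1 - w * Q ^- i) = 1 - w ^+ n.
Proof.
have := congr1 (fun p : {poly F} => p.[w]) (factor_Xn_sub_1 Qprim).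
rewrite /= horner_prod hornerD hornerN hornerXn hornerC big_mkord => E.
have E0 := congr1 (fun p : {poly F} => p.[0]) (factor_Xn_sub_1 Qprim).
rewrite /= horner_prod hornerD hornerN hornerXn hornerC big_mkord in E0.
rewrite expr0n gtn_eqF ?(prim_order_gt0 Qprim) // add0r in E0.
rewrite -[RHS]opprB -E.
have -> : - \prod_(i < n) ('X - (Q ^+ i)%:P).[w] =
   \prod_(i < n) ('X - (Q ^+ i)%:P).[w] / \prod_(i < n) ('X - (Q ^+ i)%:P).[0].
  by rewrite E0 invrN1 mulrN1.
rewrite -prodf_div; apply: eq_bigr => i _; rewrite !hornerXsubC.
have Qi : Q ^+ i != 0 by rewrite expf_neq0.
move: Qi; set q := Q ^+ i => Qi. by field; rewrite ?sub0r ?oppr_eq0 ?Qi. 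
Qed.

Lemma sum_prim k : \sum_(j < n) (Q ^+ k) ^+ j = (n %| k)%N%:R * n%:R.
Proof.
case: (boolP (n %| k)%N) => [nk|nk].
  rewrite (eq_bigr (fun=> 1)); first by rewrite sumr_const card_ord mul1r.
  move=> j _; rewrite -exprM; apply/eqP; rewrite -(prim_order_dvd Qprim).
  exact: dvdn_mulr.
have := qnE n (Q ^+ k); rewrite -exprM mulnC exprM (prim_expr_order Qprim).
rewrite expr1n subrr => /eqP; rewrite mulf_eq0 subr_eq0 eq_sym.
by rewrite -(prim_order_dvd Qprim) (negbTE nk) mul0r => /eqP.
Qed.

(** The sum over j keeps the exponents s with n | s + 1; the degree bound 2n - 2 leaves only s = n -
    1. *)
Lemma sum_prim_horner (p : {poly F}) (x : F) : (size p < n.*2)%N ->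
  \sum_(j < n) Q ^+ j * p.[x * Q ^+ j] = n%:R * p`_n.-1 * x ^+ n.-1.
Proof.
move=> szp; have n0 := prim_order_gt0 Qprim.
have Qs s j : (Q ^+ s.+1) ^+ j = Q ^+ j * (Q ^+ j) ^+ s.
  by rewrite -!exprM mulSn exprD [(s * j)%N]mulnC.
under eq_bigr => j _ do rewrite (horner_coef_wide _ (ltnW szp)) big_distrr.
rewrite exchange_big /=.
have lt : (n.-1 < n.*2)%N by rewrite -addnn (leq_trans _ (leq_addr _ _)) ?prednK.
rewrite (bigD1 (Ordinal lt)) //= [X in _ + X]big1 ?addr0 => [|s sn].
  rewrite (eq_bigr (fun j : 'I_n => p`_n.-1 * x ^+ n.-1 * (Q ^+ n) ^+ j)).
    by rewrite -mulr_sumr sum_prim dvdnn mul1r; ring.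
  move=> j _; have -> : Q ^+ n = Q ^+ n.-1.+1 by rewrite prednK.
  by rewrite Qs exprMn /=; ring.
rewrite (eq_bigr (fun j : 'I_n => p`_s * x ^+ s * (Q ^+ s.+1) ^+ j)).
  rewrite -mulr_sumr sum_prim.
  case: (boolP (n %| s.+1)%N) => [/dvdnP[k sk]|_]; last by rewrite mul0r mulr0.
  case: k sk => [|[|k]] // sk.
    have e : val s = n.-1 by apply: succn_inj; rewrite sk mul1n prednK.
    by move: sn; rewrite -val_eqE /= e eqxx.
  suff -> : p`_s = 0 by rewrite !mul0r.
  apply: nth_default; rewrite -ltnS sk; apply: leq_trans szp _.
  by rewrite -addnn !mulSn addnA leq_addr.
by move=> j _; rewrite Qs exprMn; ring.
Qed.

End PrimitiveRoot.

(** * The sum over one block as a function of x, E, E' and Q *)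

Section Beta.
Variables (F : fieldType) (n : nat).
Implicit Types (m : nat) (Q E x z : F).

(** The factors m < i < n are put into the numerator so that the denominator runs over all i < n, a
    full product when Q is a root of unity. Its factor i = j equals 1 - x E at z = x Q^j and
    vanishes for x = E = 1; [denom] leaves it out. *)
Definition numer m Q E z : F :=
  \prod_(i < m) (1 - z * (Q ^+ i.+1 / E))
  * \prod_(m.+1 <= i < n) (1 - z * (Q ^- i * E)).

Definition denom Q E z (j : nat) : F :=
  \prod_(i < n | i != j :> nat) (1 - z * (Q ^- i * E)).

(* (1 - x E) times the value at z = x Q^j of
   \prod_(1 <= i <= m) (1 - z Q^i / E) / \prod_(0 <= i <= m) (1 - z Q^-i E). *)
Definition beta m Q E x (j : nat) : F :=
  numer m Q E (x * Q ^+ j) / denom Q E (x * Q ^+ j) j.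

Definition gsum m m' Q E E' x : F :=
  \sum_(j < n) Q ^+ j * (beta m Q E x j * beta m' Q E' x j).

Lemma numer_poly m Q E : (m < n)%N ->
  exists2 p : {poly F}, (size p <= n)%N & forall z, p.[z] = numer m Q E z.
Proof.
move=> mn; pose lin (a : F) : {poly F} := 1 - a *: 'X.
have szlin a : (size (lin a) <= 2)%N.
  rewrite (leq_trans (size_polyD _ _)) // size_polyN size_poly1 geq_max /=.
  by rewrite (leq_trans (size_scale_leq _ _)) ?size_polyX.
have linE a z : (lin a).[z] = 1 - z * a by rewrite /lin !hornerE mulrC.
have szM (T : eqType) (r : seq T) (g : T -> F) :
    (size (\prod_(i <- r) lin (g i))%R <= (size r).+1)%N.
  elim: r => [|i r IH]; first by rewrite big_nil size_poly1.
  rewrite big_cons (leq_trans (size_polyMleq _ _)) //=.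
  move: (szlin (g i)) IH; move: (size _) (size _) => u v; lia.
exists (\prod_(i <- index_enum 'I_m) lin (Q ^+ i.+1 / E)
        * \prod_(i <- index_iota m.+1 n) lin (Q ^- i * E)).
  rewrite (leq_trans (size_polyMleq _ _)) //.
  have h1 := szM _ (index_enum 'I_m) (fun i => Q ^+ i.+1 / E).
  have h2 := szM _ (index_iota m.+1 n) (fun i => Q ^- i * E).
  move: h1 h2; rewrite size_iota /index_enum -enumT size_enum_ord.
  move: (size _) (size _) => u v; lia.
move=> z; rewrite hornerM !horner_prod /numer; congr (_ * _).
  by apply: eq_bigr => i _; rewrite linE.
by apply: eq_bigr => i _; rewrite linE.
Qed.

Lemma denom_prim Q E x j : n.-primitive_root Q -> (j < n)%N -> x * E != 1 ->
  denom Q E (x * Q ^+ j) j = qn n (x * E).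
Proof.
move=> Qp jn xE.
have Qj : Q ^+ j != 0.
  apply/eqP => e; have := prim_expr_order Qp.
  have n0 := prim_order_gt0 Qp.
  by rewrite -(subnKC jn) addSn -addnS exprD e mul0r => /eqP; rewrite eq_sym oner_eq0.
apply: (@mulfI _ (1 - x * E)); first by rewrite subr_eq0 eq_sym.
rewrite qnE; have := prod_prim Qp (x * Q ^+ j * E).
rewrite (bigD1 (Ordinal jn)) //= !exprMn -[(Q ^+ j) ^+ n]exprM mulnC exprM.
rewrite (prim_expr_order Qp) expr1n mulr1 => <-; congr (_ * _).
  by rewrite mulrAC mulfK.
by apply: eq_bigr => i _; rewrite -!mulrA; congr (1 - _ * (_ * _)); rewrite mulrC.
Qed.

(** By [denom_prim] the denominators no longer depend on j, so [sum_prim_horner] applies to the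
    product of the numerators, of degree at most 2n - 2. What matters later is that K is independent
    of x. *)
Lemma gsum_prim m m' Q E E' : (m < n)%N -> (m' < n)%N -> n.-primitive_root Q ->
  exists K, forall x, x * E != 1 -> x * E' != 1 ->
  gsum m m' Q E E' x = K * (x ^+ n.-1 / (qn n (x * E) * qn n (x * E'))).
Proof.
move=> mn m'n Qp; have [p szp pE] := numer_poly Q E mn.
have [p' szp' p'E] := numer_poly Q E' m'n.
have szpp : (size (p * p')%R < n.*2)%N.
  rewrite (leq_ltn_trans (size_polyMleq _ _)) // -addnn.
  move: szp szp' (prim_order_gt0 Qp); move: (size p) (size p') => u v; lia.
exists (n%:R * (p * p')`_n.-1) => x xE xE'.
rewrite mulrA -(sum_prim_horner Qp) // mulr_suml; apply: eq_bigr => j _.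
rewrite /beta !denom_prim // hornerM pE p'E -!mulrA; congr (_ * _).
by rewrite !mulrA [in RHS]invfM; ring.
Qed.

(* For E = 1 and E' = 1/x, the two sides are, up to the same factor and opposite
   signs, the sums of the residues at the poles Q^j and at the poles x Q^j of the
   product of the two rational functions behind [beta]. *)
Lemma gsum_residue m m' Q x : (m < n)%N -> (m' < n)%N -> x != 0 -> Q != 0 ->
  (forall i j, (i < n)%N -> (j < n)%N -> i != j -> Q ^+ i != Q ^+ j) ->
  (forall i j, (i < n)%N -> (j < n)%N -> Q ^+ i != x * Q ^+ j) ->
  gsum m m' Q 1 x^-1 1 = gsum m m' Q 1 x^-1 x.
Proof.
move=> mn m'n x0 Q0 Qinj Qx.
have [p szp pE] := numer_poly Q 1 mn.
have [p' szp' p'E] := numer_poly Q x^-1 m'n.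
pose z (s : 'I_n + 'I_n) : F := match s with inl i => Q ^+ i | inr i => x * Q ^+ i end.
have z_inj : injective z.
  move=> [i|i] [j|j] /= e.
  - congr inl; apply: val_inj; apply/eqP; case: (eqVneq (val i) (val j)) => // ij.
    by have := Qinj i j (ltn_ord _) (ltn_ord _) ij; rewrite e eqxx.
  - by have := Qx i j (ltn_ord _) (ltn_ord _); rewrite e eqxx.
  - by have := Qx j i (ltn_ord _) (ltn_ord _); rewrite e eqxx.
  - congr inr; apply: val_inj; apply/eqP; case: (eqVneq (val i) (val j)) => // ij.
    by have := Qinj i j (ltn_ord _) (ltn_ord _) ij; rewrite (mulfI x0 e) eqxx.
have z0 s : z s != 0 by case: s => i /=; rewrite ?mulf_neq0 ?expf_neq0.
have n0 : (0 < n)%N by apply: leq_ltn_trans mn.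
have x1 : x != 1.
  by apply/eqP => e; have := Qx 0 0 n0 n0; rewrite e !mul1r eqxx.
have szpp : (size (p * p')%R < #|{: 'I_n + 'I_n}|)%N.
  rewrite card_sum card_ord (leq_ltn_trans (size_polyMleq _ _)) //.
  move: szp szp' n0; move: (size p) (size p') => u v; lia.
have := residue_sum0 z_inj z0 szpp.
rewrite big_sumType /=.
have xn1 : 1 - x^-1 != 0 by rewrite subr_eq0 eq_sym invr_eq1.
have xn2 : 1 - x != 0 by rewrite subr_eq0 eq_sym.
rewrite [X in X + _](_ : _ = gsum m m' Q 1 x^-1 1 / (1 - x^-1)); last first.
  rewrite /gsum mulr_suml; apply: eq_bigr => j _.
  rewrite hornerM pE p'E big_sumType /= [X in _ / (_ * X)](bigD1 j) //=.
  rewrite /beta /denom !mul1r.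
  have -> : \prod_(i < n | inl i != inl j :> 'I_n + 'I_n) (1 - Q ^+ j / Q ^+ i) =
     \prod_(i < n | i != j :> nat) (1 - Q ^+ j * (Q ^- i * 1)).
    by apply: eq_bigr => i _; rewrite mulr1.
  have -> : \prod_(i < n | i != j) (1 - Q ^+ j / (x * Q ^+ i)) =
     \prod_(i < n | i != j :> nat) (1 - Q ^+ j * (Q ^- i * x^-1)).
    by apply: eq_bigr => i _; rewrite invfM [x^-1 * _]mulrC.
  have -> : Q ^+ j / (x * Q ^+ j) = x^-1 by rewrite invfM mulrCA mulfV ?mulr1 ?expf_neq0.
  by rewrite !invfM; ring.
rewrite [X in _ + X](_ : _ = x * gsum m m' Q 1 x^-1 x / (1 - x)); last first.
  rewrite /gsum mulr_sumr mulr_suml; apply: eq_bigr => j _.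
  rewrite hornerM pE p'E big_sumType /= [X in _ / (X * _)](bigD1 j) //=.
  rewrite /beta /denom.
  have -> : \prod_(i < n | inr i != inr j :> 'I_n + 'I_n) (1 - x * Q ^+ j / (x * Q ^+ i)) =
     \prod_(i < n | i != j :> nat) (1 - x * Q ^+ j * (Q ^- i * x^-1)).
    by apply: eq_bigr => i _; rewrite invfM [x^-1 * _]mulrC.
  have -> : \prod_(i < n | i != j) (1 - x * Q ^+ j / Q ^+ i) =
     \prod_(i < n | i != j :> nat) (1 - x * Q ^+ j * (Q ^- i * 1)).
    by apply: eq_bigr => i _; rewrite mulr1.
  have -> : x * Q ^+ j / Q ^+ j = x by rewrite mulfK ?expf_neq0.
  by rewrite !invfM; ring.
move: (gsum _ _ _ _ _ 1) (gsum _ _ _ _ _ x) => g1 g2.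
have -> : g1 / (1 - x^-1) = - (x * g1 / (1 - x)).
  have -> : 1 - x^-1 = - (1 - x) / x by field.
  by rewrite invfM invrK invrN; ring.
rewrite addrC -mulrBl -mulrBr => /eqP; rewrite !mulf_eq0 invr_eq0 (negbTE xn2) (negbTE x0).
by rewrite orbF /= subr_eq0 eq_sym => /eqP.
Qed.

End Beta.

(** * Exact factorization of a block of n terms *)

(** This is 1 - ((E - 1)^2 / E) * w / (1 - w)^2, hence 1 up to second order in E - 1. [rho] collects
    such factors along the current row, [psi] those of a completed row except the one at w Q^n,
    where 1 - w Q^n is small. *)
Definition theta (F : fieldType) (E w : F) : F :=
  (1 - w / E) * (1 - w * E) / (1 - w) ^+ 2.

Definition rho (F : fieldType) (Q E x : F) (j : nat) : F :=
  \prod_(i < j) theta E (x * Q ^+ i.+1).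

Definition psi (F : fieldType) (n : nat) (Q E w : F) : F :=
  \prod_(s < n.-1) theta E (w * Q ^+ s.+1).

Definition pair (F : fieldType) (d a k : nat) (q : F) : F :=
  qpoch (q ^+ a) (q ^+ d) k * qpoch (q ^+ (d - a)) (q ^+ d) k
  / qpoch (q ^+ d) (q ^+ d) k ^+ 2.

Lemma qpochS (F : fieldType) (a x : F) k :
  qpoch a x k.+1 = qpoch a x k * (1 - a * x ^+ k).
Proof. by rewrite /qpoch big_ord_recr. Qed.

Lemma pairS (F : fieldType) (d a k : nat) (q : F) :
  pair d a k.+1 q = pair d a k q
    * ((1 - q ^+ (a + d * k)) * (1 - q ^+ (d - a + d * k)) / (1 - q ^+ (d + d * k)) ^+ 2).
Proof. by rewrite /pair !qpochS -!exprM -!exprD !exprMn !invfM; ring. Qed.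

Lemma prod_block (R : comPzRingType) (f : nat -> R) (n l j : nat) :
  \prod_(i < l * n + j) f i =
  (\prod_(k < l) \prod_(s < n) f (k * n + s)%N) * \prod_(s < j) f (l * n + s)%N.
Proof.
elim: l j => [|l IH] j.
  by rewrite big_ord0 mul1r mul0n add0n; apply: eq_bigr => s _; rewrite add0n.
rewrite mulSnr -addnA IH big_split_ord /= big_ord_recr /= -!mulrA.
by congr (_ * (_ * _)); apply: eq_bigr => s _; rewrite addnA.
Qed.

Lemma prod_shift (R : comPzRingType) (f : nat -> R) m :
  (\prod_(i < m) f i.+1) * f 0 = (\prod_(i < m) f i) * f m.
Proof.
transitivity (\prod_(i < m.+1) f i); last by rewrite big_ord_recr.
by rewrite big_ord_recl mulrC.
Qed.

Section Block.
Variables (F : fieldType) (n d m a a' : nat) (q : F).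
Hypothesis n0 : (0 < n)%N.
Hypothesis a0d : (0 < a < d)%N.
Hypothesis a'0d : (0 < a' < d)%N.
Hypothesis mn : (m < n)%N.
Hypothesis aE : (a + d * m = n * a')%N.
Hypothesis q0 : q != 0.
Hypothesis q_inj : forall i j, q ^+ i = q ^+ j -> i = j.

Let Q := q ^+ d.
Let E := q ^+ (n * a').

Let Q0 : Q != 0. Proof. exact: expf_neq0. Qed.
Let E0 : E != 0. Proof. exact: expf_neq0. Qed.

(** Modulo d the exponent of q is 0 on the left and a on the right, as E = q^(a + d m). *)
Let QE u v : Q ^+ u != Q ^+ v * E.
Proof.
apply/eqP; rewrite -!exprM -exprD => /q_inj e; move: a0d.
by have := congr1 (modn^~ d) e; rewrite -aE addnCA -mulnDr modnMr addnC mulnC modnMDl modn_small; lia.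
Qed.

Let QE1 u v : 1 - Q ^+ u * (Q ^- v * E) != 0.
Proof.
rewrite subr_eq0; apply/eqP => e; have := QE v u; rewrite -{1}[Q ^+ v]mulr1 e.
by rewrite mulrCA mulVKf ?eqxx ?expf_neq0.
Qed.

Let QE2 u v : 1 - Q ^+ u * (Q ^+ v / E) != 0.
Proof.
rewrite subr_eq0; apply/eqP => e; have := QE (u + v) 0.
by rewrite mul1r exprD -[E]mul1r {1}e -mulrA mulfVK ?eqxx.
Qed.

Let Qneq1 u : (0 < u)%N -> 1 - Q ^+ u != 0.
Proof.
move=> u0; rewrite subr_eq0 eq_sym -(expr0 q) -exprM; apply/eqP => /q_inj.
by move/eqP; rewrite muln_eq0; move: a0d u0; lia.
Qed.

(** The function behind [beta]. It converts the factors 1 - q^(a + d k) and 1 - q^(d - a + d k) of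
    [pair] into the factors of [theta] at Q^(k+1). *)
Definition ratP z : F :=
  \prod_(i < m) (1 - z * (Q ^+ i.+1 / E)) / \prod_(i < m.+1) (1 - z * (Q ^- i * E)).

Lemma ratP_neq0 k : ratP (Q ^+ k) != 0.
Proof.
by apply: mulf_neq0; rewrite ?invr_eq0; apply/prodf_neq0 => i _; [apply: QE2|apply: QE1].
Qed.

(** Replacing z by Q z shifts the index in both products by one, so only end factors remain; Q^(m+1)
    / E = q^(d-a) and E / Q^m = q^a identify them. *)
Lemma ratP_shift k : ratP (Q ^+ k.+1) * ((1 - Q ^+ k.+1 / E) * (1 - Q ^+ k.+1 * E)) =
  ratP (Q ^+ k) * ((1 - q ^+ (a + d * k)) * (1 - q ^+ (d - a + d * k))).
Proof.
have N1 : \prod_(i < m) (1 - Q ^+ k.+1 * (Q ^+ i.+1 / E)) * (1 - Q ^+ k.+1 / E) =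
   \prod_(i < m) (1 - Q ^+ k * (Q ^+ i.+1 / E)) * (1 - q ^+ (d - a + d * k)).
  have -> : q ^+ (d - a + d * k) = Q ^+ k * (Q ^+ m.+1 / E).
    apply: (mulIf E0); rewrite mulrA mulfVK // -!exprM -!exprD; congr (_ ^+ _).
    move: a0d aE; nia.
  rewrite -(prod_shift (fun i => 1 - Q ^+ k * (Q ^+ i.+1 / E))); congr (_ * _).
    by apply: eq_bigr => i _; rewrite !exprS; congr (1 - _); ring.
  by rewrite exprSr -mulrA expr1.
have D1 : \prod_(i < m.+1) (1 - Q ^+ k.+1 * (Q ^- i * E)) * (1 - q ^+ (a + d * k)) =
   \prod_(i < m.+1) (1 - Q ^+ k * (Q ^- i * E)) * (1 - Q ^+ k.+1 * E).
  have -> : q ^+ (a + d * k) = Q ^+ k.+1 * (Q ^- m.+1 * E).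
    apply: (mulfI (expf_neq0 m.+1 Q0)); rewrite mulrCA mulVKf ?expf_neq0 //.
    rewrite -!exprM -!exprD; congr (_ ^+ _); move: a0d aE; nia.
  rewrite -(prod_shift (fun i => 1 - Q ^+ k.+1 * (Q ^- i * E))); congr (_ * _).
    apply: eq_bigr => i _; rewrite !exprS; congr (1 - _).
    by field; rewrite Q0 expf_neq0.
  by rewrite expr0 invr1 mul1r.
rewrite /ratP.
have nz u : \prod_(i < m.+1) (1 - Q ^+ u * (Q ^- i * E)) != 0 by apply/prodf_neq0 => i _.
move: (nz k) (nz k.+1) N1 D1.
move: (\prod_(i < m.+1) _) (\prod_(i < m.+1) _) => D' D D0 D'0.
move: (\prod_(i < m) _) (\prod_(i < m) _) => N N' N1 D1.
move: N1 D1; set f1 := 1 - q ^+ (a + _); set f2 := 1 - q ^+ (d - a + _).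
set e1 := 1 - _ / E; set e2 := 1 - _ * E => N1 D1.
transitivity (N' * e1 * (e2 / D')); first by ring.
have -> : e2 / D' = f1 / D.
  by apply/eqP; rewrite eqr_div // mulrC -D1 mulrC.
by rewrite N1; ring.
Qed.

Lemma pair_ratP k : pair d a k q =
  ratP (Q ^+ k) / ratP 1 * \prod_(i < k) theta E (Q ^+ i.+1).
Proof.
have P0 k' := ratP_neq0 k'; have P10 : ratP 1 != 0 by rewrite -(expr0 Q).
elim: k => [|k IH].
  by rewrite expr0 divff // big_ord0 /pair /qpoch !big_ord0 expr1n invr1 !mulr1.
rewrite pairS IH big_ord_recr /= /theta.
have -> : q ^+ (d + d * k) = Q ^+ k.+1 by rewrite -exprM mulnS.
have e1 : 1 - Q ^+ k.+1 / E != 0 by have := QE2 k.+1 0; rewrite expr0 mul1r.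
have e2 : 1 - Q ^+ k.+1 * E != 0 by have := QE1 k.+1 0; rewrite expr0 invr1 mul1r.
have e3 := Qneq1 (ltn0Sn k).
move: (P0 k) (ratP_shift k) e1 e2 e3.
set f1 := 1 - q ^+ (a + _); set f2 := 1 - q ^+ (d - a + _).
set u1 := 1 - _ / E; set u2 := 1 - _ * E; set v := 1 - Q ^+ _ => Pk sh e1 e2 e3.
have -> : ratP (Q ^+ k.+1) = ratP (Q ^+ k) * (f1 * f2) / (u1 * u2).
  by rewrite -sh mulfK // mulf_neq0.
by field; rewrite P10 e1 e2 e3.
Qed.

Lemma beta_ratP l j : (j < n)%N ->
  beta n m Q E (Q ^+ (n * l)) j = (1 - Q ^+ (n * l) * E) * ratP (Q ^+ (n * l + j)).
Proof.
move=> jn; rewrite /beta /numer /denom -exprD /ratP; set z := Q ^+ _.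
have nz i : 1 - z * (Q ^- i * E) != 0 by apply: QE1.
have D0 : \prod_(i < n | i != j :> nat) (1 - z * (Q ^- i * E)) != 0.
  by apply/prodf_neq0 => i _.
have D1 : \prod_(i < m.+1) (1 - z * (Q ^- i * E)) != 0 by apply/prodf_neq0 => i _.
have e : 1 - Q ^+ (n * l) * E = 1 - z * (Q ^- j * E).
  by rewrite /z exprD -mulrA mulVKf ?expf_neq0.
have split : (1 - z * (Q ^- j * E)) * \prod_(i < n | i != j :> nat) (1 - z * (Q ^- i * E))
  = \prod_(i < m.+1) (1 - z * (Q ^- i * E)) * \prod_(m.+1 <= i < n) (1 - z * (Q ^- i * E)).
  transitivity (\prod_(i < n) (1 - z * (Q ^- i * E))); first by rewrite [RHS](bigD1 (Ordinal jn)).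
  rewrite -!(big_mkord xpredT (fun i => 1 - z * (Q ^- i * E))).
  by rewrite (@big_cat_nat _ _ _ m.+1).
rewrite e; move: (nz j) D0 D1 split.
move: (1 - _) (\prod_(i < n | _) _) (\prod_(i < m.+1) _) (\prod_(_ <= i < n) _) (\prod_(i < m) _).
move=> f D P N M f0 D0 P0 fD.
apply: (mulIf D0); rewrite mulfVK // mulrAC fD; field.
by rewrite P0.
Qed.

(** These are the last factors of the completed rows. Since Q^n = (q^n)^d and E = (q^n)^a', they are
    factors of [pair] at q^n, with those for a' shifted by one step; the shift leaves the quotient
    of end factors. *)
Lemma coarse_theta l : \prod_(k < l) theta E (Q ^+ (n * k.+1)) =
  pair d a' l (q ^+ n) * (1 - Q ^+ (n * l) * E) / (1 - E).
Proof.
have E1 : 1 - E != 0 by have := QE1 0 0; rewrite expr0 invr1 !mul1r.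
elim: l => [|l IH].
  rewrite big_ord0 muln0 expr0 mul1r /pair /qpoch !big_ord0 expr1n invr1 !mul1r.
  by rewrite divff.
rewrite big_ord_recr /= IH pairS /theta.
have -> : (q ^+ n) ^+ (a' + d * l) = Q ^+ (n * l) * E.
  by rewrite -!exprM -exprD; congr (_ ^+ _); lia.
have -> : (q ^+ n) ^+ (d - a' + d * l) = Q ^+ (n * l.+1) / E.
  apply: (mulIf E0); rewrite mulfVK // -!exprM -!exprD; congr (_ ^+ _).
  move: a'0d; nia.
have -> : (q ^+ n) ^+ (d + d * l) = Q ^+ (n * l.+1).
  by rewrite -!exprM; congr (_ ^+ _); nia.
have e3 : 1 - Q ^+ (n * l.+1) != 0 by apply: Qneq1; rewrite muln_gt0 n0.
by field; rewrite E1 e3.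
Qed.

(** The factor 1 - Q^(n l) E left over by [coarse_theta] is exactly the one that turns [ratP] into
    [beta]. *)
Lemma pair_block l j : (j < n)%N ->
  pair d a (l * n + j) q = pair d a' l (q ^+ n)
    * \prod_(k < l) psi n Q E (Q ^+ (n * k))
    * (rho Q E (Q ^+ (n * l)) j * beta n m Q E (Q ^+ (n * l)) j / beta n m Q E 1 0).
Proof.
move=> jn; rewrite pair_ratP (prod_block (fun i => theta E (Q ^+ i.+1))) beta_ratP //.
have -> : beta n m Q E 1 0 = (1 - E) * ratP 1.
  by have := beta_ratP 0 n0; rewrite muln0 expr0 mul1r.
have -> : \prod_(k < l) \prod_(s < n) theta E (Q ^+ (k * n + s).+1) =
  \prod_(k < l) psi n Q E (Q ^+ (n * k)) * \prod_(k < l) theta E (Q ^+ (n * k.+1)).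
  rewrite -big_split /=; apply: eq_bigr => k _.
  have prodn (f : nat -> F) : \prod_(s < n) f s = (\prod_(s < n.-1) f s) * f n.-1.
    by case: n n0 => // n' _; rewrite big_ord_recr.
  rewrite (prodn (fun s => theta E (Q ^+ (k * n + s).+1))) /psi; congr (_ * _).
    by apply: eq_bigr => s _; rewrite -exprD -addnS mulnC.
  by congr (theta _ (_ ^+ _)); move: n0; nia.
have -> : \prod_(s < j) theta E (Q ^+ (l * n + s).+1) = rho Q E (Q ^+ (n * l)) j.
  by apply: eq_bigr => s _; rewrite -exprD -addnS mulnC.
rewrite coarse_theta [(l * n)%N]mulnC.
have P10 : ratP 1 != 0 by rewrite -(expr0 Q) ratP_neq0.
have E1 : 1 - E != 0 by have := QE1 0 0; rewrite expr0 invr1 !mul1r.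
by field; rewrite P10 E1.
Qed.

End Block.

(** * Congruences near a root of unity *)

Section NearRoot.
Variables (F : fieldType) (I : adic F) (n : nat) (Q0 : F).
Hypothesis Q0prim : n.-primitive_root Q0.
Hypothesis Q0I : I 0%N Q0.
Hypothesis nat_unit : forall k, (0 < k)%N -> iunit I k%:R.

Let n0 : (0 < n)%N. Proof. exact: prim_order_gt0 Q0prim. Qed.

Lemma prim_unit : iunit I Q0.
Proof.
apply: (iunitMl Q0I (adicX n.-1 Q0I)); rewrite -exprS prednK //.
rewrite (prim_expr_order Q0prim); exact: iunit1.
Qed.

Lemma prod_prim1 w : \prod_(s < n.-1) (w - Q0 ^+ s.+1) = qn n w.
Proof.
have E := factor_Xn_sub_1 Q0prim.
rewrite subrX1 (big_ltn n0) expr0 in E.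
have /mulfI X1 : 'X - 1%:P != 0 :> {poly F} by rewrite polyXsubC_eq0.
have := congr1 (fun p : {poly F} => p.[w]) (X1 _ _ E).
rewrite horner_prod horner_sum big_add1 big_mkord /= => e.
transitivity (\prod_(i < n.-1) ('X - (Q0 ^+ i.+1)%:P).[w]).
  by apply: eq_bigr => i _; rewrite hornerXsubC.
by rewrite e; apply: eq_bigr => i _; rewrite hornerXn.
Qed.

(* n is a multiple of 1 - v in the subring generated by v. *)
Lemma one_sub_unit v : I 0%N v -> v ^+ n = 1 -> v != 1 -> iunit I (1 - v).
Proof.
move=> v0 vn v1.
have s0 : qn n v = 0.
  have /eqP := qnE n v; rewrite vn subrr mulf_eq0 subr_eq0 eq_sym (negbTE v1).
  by move=> /eqP.
have E : (1 - v) * \sum_(k < n) qn k v = n%:R.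
  rewrite mulr_sumr (eq_bigr (fun k : 'I_n => 1 - v ^+ k)) => [|k _].
    by rewrite sumrB -/(qn n v) s0 subr0 sumr_const card_ord.
  exact: qnE.
apply: (iunitMl (v := \sum_(k < n) qn k v)); last by rewrite E; exact: nat_unit.
  by apply: adicB => //; exact: adic1.
by apply: adic_sum => k _; apply: adic_sum => i _; apply: adicX.
Qed.

Lemma prim_ratio_unit i j : (i < n)%N -> (j < n)%N -> i != j ->
  iunit I (1 - Q0 ^+ j * Q0 ^- i).
Proof.
move=> ni nj ij.
have Q00 := iunit_neq0 prim_unit.
apply: one_sub_unit.
- apply: adicMl; first exact: adicX.
  by apply: adic0V; apply: iunitX prim_unit.
- by rewrite expr_div_n -!exprM ![(_ * n)%N]mulnC !exprM (prim_expr_order Q0prim) !expr1n divr1.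
- apply/eqP => e; move/eqP: ij; apply.
  have /eqP : Q0 ^+ j = Q0 ^+ i.
    by rewrite -[RHS]mul1r -e mulfVK ?expf_neq0.
  by rewrite (eq_prim_root_expr Q0prim) !modn_small // => /eqP.
Qed.

Lemma prim_unit1 i : (0 < i < n)%N -> iunit I (1 - Q0 ^+ i).
Proof.
case/andP=> i0 ni; have := @prim_ratio_unit 0 i n0 ni.
by rewrite expr0 invr1 mulr1; apply; rewrite eq_sym -lt0n.
Qed.

Section Cubic.
Variable s : nat.

Lemma cubicB k (f g : cube s -> F) :
  cubic I k f -> cubic I k g -> cubic I k (fun t => f t - g t).
Proof. by move=> hf hg; apply: cubicD hf _; apply: cubicN. Qed.

Variables (x E Q : cube s -> F).
Hypothesis (xc : cubic I 0%N x) (Ec : cubic I 0%N E) (Qc : cubic I 0%N Q).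
Hypothesis (x1 : forall t, I 1%N (x t - 1)) (E1 : forall t, I 1%N (E t - 1)).
Hypothesis (Q1 : forall t, I 1%N (Q t - Q0)).

Let Eunit t : iunit I (E t). Proof. exact: iunit_close (iunit1 I) (E1 t). Qed.
Let Qunit t : iunit I (Q t). Proof. exact: iunit_close prim_unit (Q1 t). Qed.
Let QX i t : I 1%N (Q t ^+ i - Q0 ^+ i).
Proof. by apply: adicBX => //; case: (Qunit t). Qed.
Let QXV i t : I 1%N (Q t ^- i - Q0 ^- i).
Proof. by apply: adicBV => //; apply: iunitX => //; exact: prim_unit. Qed.

Let one : cubic I 0%N (fun _ : cube s => 1). Proof. exact: cubicC (adic1 I). Qed.

Lemma linear_cubic (f : cube s -> F) : cubic I 0%N f ->
  cubic I 0%N (fun t => 1 - f t).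
Proof. exact: cubicB. Qed.

Let QXVc i : cubic I 0%N (fun t => Q t ^- i).
Proof. by apply: cubicV (cubicX i Qc) _ => t; case: (iunitX i (Qunit t)). Qed.

(** The denominators are units because x Q^j Q^-i E is close to Q0^(j-i), which differs from 1 for i
    != j. *)
Lemma beta_cubic m j : (m < n)%N -> (j < n)%N ->
  cubic I 0%N (fun t => beta n m (Q t) (E t) (x t) j).
Proof.
move=> mn jn; have xQ : cubic I 0%N (fun t => x t * Q t ^+ j).
  by apply: (cubicM (k := 0%N) (l := 0%N)) => //; apply: cubicX.
apply: (cubicM (k := 0%N) (l := 0%N)).
  apply: (cubicM (k := 0%N) (l := 0%N)).
    apply: cubic_prod => i _; apply: linear_cubic.
    apply: (cubicM (k := 0%N) (l := 0%N)) => //.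
    apply: (cubicM (k := 0%N) (l := 0%N)); first exact: cubicX.
    by apply: cubicV => // t; case: (Eunit t).
  apply: cubic_prod => i _; apply: linear_cubic.
  apply: (cubicM (k := 0%N) (l := 0%N)) => //.
  exact: (cubicM (k := 0%N) (l := 0%N)).
apply: cubicV => [|t].
  apply: cubic_prod => i _; apply: linear_cubic.
  apply: (cubicM (k := 0%N) (l := 0%N)) => //.
  exact: (cubicM (k := 0%N) (l := 0%N)).
suff : iunit I (denom n (Q t) (E t) (x t * Q t ^+ j) j) by case.
apply: iunit_prod => i ij.
apply: iunit_close (prim_ratio_unit (ltn_ord i) jn ij) _.
have -> : 1 - x t * Q t ^+ j * (Q t ^- i * E t) - (1 - Q0 ^+ j * Q0 ^- i)
  = Q0 ^+ j * Q0 ^- i - (x t * E t) * (Q t ^+ j * Q t ^- i) by ring.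
apply: adicBC; rewrite -[X in _ - X]mul1r.
have Qi0 : I 0%N (Q t ^- i) by apply: adic0V; apply: iunitX.
have Qj0 : I 0%N (Q t ^+ j) by case: (iunitX j (Qunit t)).
have E0 : I 0%N (E t) by case: (Eunit t).
apply: adicBM; [exact: adic1| exact: adicMl | | ].
  rewrite -[X in _ - X](mulr1 1); apply: adicBM => //; exact: adic1.
by apply: adicBM => //; apply: adicX.
Qed.

(** In - ((e - 1)^2 / e) * w / (1 - w)^2 the constant supplies order 2, and w / (1 - w)^2 is regular
    since w is close to Q0^i. *)
Lemma theta_cubic i e : (0 < i < n)%N -> iunit I e -> I 1%N (e - 1) ->
  cubic I 2%N (fun t => theta e (x t * Q t ^+ i) - 1).
Proof.
move=> i0n eu e1.
have wc : cubic I 0%N (fun t => x t * Q t ^+ i).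
  by apply: (cubicM (k := 0%N) (l := 0%N)) => //; apply: cubicX.
have wu t : iunit I ((1 - x t * Q t ^+ i)).
  apply: iunit_close (prim_unit1 i0n) _.
  have -> : 1 - x t * Q t ^+ i - (1 - Q0 ^+ i) = 1 * Q0 ^+ i - x t * Q t ^+ i by ring.
  apply: adicBC; apply: adicBM => //; first exact: adic1.
  by apply: adicX; case: (Qunit t).
have e2 : I 2%N (- ((e - 1) ^+ 2 / e)).
  by apply: adicN; apply: adicMr; [exact: adicXn|exact: adic0V].
have c1 : cubic I 0%N (fun t => ((1 - x t * Q t ^+ i) ^+ 2)^-1).
  apply: cubicV => [|t]; last by case: (iunitX 2 (wu t)).
  by apply: cubicX; apply: linear_cubic.
have := cubicM (cubicC s e2) (cubicM wc c1).
apply: cubic_ext => t; rewrite /theta.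
have := iunit_neq0 (wu t); have := iunit_neq0 eu.
move: (x t * _) => w e0 w0; field.
by rewrite w0 e0.
Qed.

Lemma cubic2_prod (T : Type) (r : seq T) (P : pred T) (G : T -> cube s -> F) :
  (forall i, P i -> cubic I 2%N (fun t => G i t - 1)) ->
  cubic I 2%N (fun t => \prod_(i <- r | P i) G i t - 1).
Proof.
move=> h; elim: r => [|i r IH].
  by apply: cubic_ext (cubic0 I s 2) => t; rewrite big_nil subrr.
case: (boolP (P i)) => Pi; last first.
  by apply: cubic_ext IH => t; rewrite big_cons (negbTE Pi).
have IH0 : cubic I 0%N (fun t => \prod_(i <- r | P i) G i t).
  apply: cubic_ext (cubicD (cubicW (cubicW IH)) one) => t; by rewrite subrK.
have := cubicD (cubicM (h i Pi) IH0) IH.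
by apply: cubic_ext => t; rewrite big_cons Pi; ring.
Qed.

End Cubic.

End NearRoot.

(** * Comparison of the block sums up to order 3 *)

Definition rsum (F : fieldType) (n m m' : nat) (Q E E' x : F) : F :=
  \sum_(j < n) Q ^+ j * ((rho Q E x j * beta n m Q E x j)
                         * (rho Q E' x j * beta n m' Q E' x j)).

Section Differences.
Variables (F : fieldType) (I : adic F) (n m m' : nat) (Q Q0 E E' x : F).
Hypothesis Q0prim : n.-primitive_root Q0.
Hypothesis Q0I : I 0%N Q0.
Hypothesis nat_unit : forall k, (0 < k)%N -> iunit I k%:R.
Hypothesis mn : (m < n)%N.
Hypothesis m'n : (m' < n)%N.
Hypothesis Q1 : I 1%N (Q - Q0).
Hypothesis E1 : I 1%N (E - 1).
Hypothesis E'1 : I 1%N (E' - 1).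
Hypothesis x1 : I 1%N (x - 1).

Let n0 : (0 < n)%N. Proof. exact: prim_order_gt0 Q0prim. Qed.
Let Q0u : iunit I Q0. Proof. exact: prim_unit Q0prim Q0I. Qed.
Let Qu : iunit I Q. Proof. exact: iunit_close Q0u Q1. Qed.
Let xu : iunit I x. Proof. exact: iunit_close (iunit1 I) x1. Qed.
Let Eu : iunit I E. Proof. exact: iunit_close (iunit1 I) E1. Qed.
Let E'u : iunit I E'. Proof. exact: iunit_close (iunit1 I) E'1. Qed.
Let u1 := iunit1 I.
Let rr (k : nat) v : I k (v - v). Proof. by rewrite subrr; exact: adic0. Qed.
Let x1V : I 1%N (x^-1 - 1). Proof. by rewrite -invr1; exact: adicBV. Qed.

Let close v w : iunit I v -> iunit I w -> I 1%N (v - 1) -> I 1%N (w - 1) -> I 1%N (v - w).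
Proof. by move=> _ _ hv hw; apply: (adicB_trans hv); apply: adicBC. Qed.

Lemma gsum_cubic s (X e e' q : cube s -> F) :
  cubic I 0%N X -> cubic I 0%N e -> cubic I 0%N e' -> cubic I 0%N q ->
  (forall t, I 1%N (X t - 1)) -> (forall t, I 1%N (e t - 1)) ->
  (forall t, I 1%N (e' t - 1)) -> (forall t, I 1%N (q t - Q0)) ->
  cubic I 0%N (fun t => gsum n m m' (q t) (e t) (e' t) (X t)).
Proof.
move=> Xc ec e'c qc X1 e1 e'1 q1; apply: cubic_sum => j _.
apply: (cubicM (k := 0%N) (l := 0%N)); first exact: cubicX.
by apply: (cubicM (k := 0%N) (l := 0%N)); apply: (beta_cubic Q0prim).
Qed.

(* The three toggles are x against 1, (E, E') against (1, 1/x), and Q against Q0;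
   the mixed third difference is of order 3, and by the residue theorem the
   differences in x vanish at (1, 1/x). *)
Lemma gsum_diff :
  gsum n m m' Q 1 x^-1 1 = gsum n m m' Q 1 x^-1 x ->
  gsum n m m' Q0 1 x^-1 1 = gsum n m m' Q0 1 x^-1 x ->
  I 3%N ((gsum n m m' Q E E' x - gsum n m m' Q E E' 1)
       - (gsum n m m' Q0 E E' x - gsum n m m' Q0 E E' 1)).
Proof.
move=> eQ eQ0.
pose X (t : cube 3) := if t.1 then x else 1.
pose e (t : cube 3) := if t.2.1 then E else 1.
pose e' (t : cube 3) := if t.2.1 then E' else x^-1.
pose q (t : cube 3) := if t.2.2.1 then Q else Q0.
have Xc : cubic I 0%N X by apply: (cubic_toggle 2); [case: xu|case: u1|].
have ec : cubic I 0%N e.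
  apply: (cubic_lift (f := fun t : cube 2 => if t.1 then E else 1)).
  by apply: cubic_toggle; [case: Eu|case: u1|].
have e'c : cubic I 0%N e'.
  apply: (cubic_lift (f := fun t : cube 2 => if t.1 then E' else x^-1)).
  apply: cubic_toggle; [by case: E'u|exact: adic0V|].
  by apply: close => //; apply: iunitV.
have qc : cubic I 0%N q.
  apply: (cubic_lift (f := fun t : cube 2 => if t.2.1 then Q else Q0)).
  apply: (cubic_lift (f := fun t : cube 1 => if t.1 then Q else Q0)).
  by apply: cubic_toggle; [case: Qu| |].
have X1 t : I 1%N (X t - 1) by case: t => [[] t].
have e1 t : I 1%N (e t - 1) by case: t => [b [[] t]].
have e'1 t : I 1%N (e' t - 1) by case: t => [b [[] t]].
have q1 t : I 1%N (q t - Q0) by case: t => [b [c [[] t]]].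
have [_ [_ [_ /= h]]] := gsum_cubic Xc ec e'c qc X1 e1 e'1 q1.
rewrite /X /e /e' /q /= eQ eQ0 !subrr !subr0 in h.
move: h; congr (adic_ideal I 3%N _); ring.
Qed.

Lemma gsum_near : I 1%N (gsum n m m' Q E E' 1 - gsum n m m' Q0 E E' 1).
Proof.
pose q (t : cube 1) := if t.1 then Q else Q0.
have qc : cubic I 0%N q by apply: cubic_toggle; [case: Qu| |].
have q1 t : I 1%N (q t - Q0) by case: t => [[] t].
have [_ /= h] := @gsum_cubic 1 (fun=> 1) (fun=> E) (fun=> E') q (cubicC 1 (adic1 I))
  (cubicC 1 (proj1 Eu)) (cubicC 1 (proj1 E'u)) qc (fun=> rr 1%N 1) (fun=> E1) (fun=> E'1) q1.
exact: h.
Qed.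

Section RhoCubic.
Variables (s : nat) (X : cube s -> F).
Hypotheses (Xc : cubic I 0%N X) (X1 : forall t, I 1%N (X t - 1)).
Let cc v : I 0%N v -> cubic I 0%N (fun _ : cube s => v) := @cubicC _ _ s 0 v.

Lemma rsum_cubic : cubic I 2%N (fun t => rsum n m m' Q E E' (X t) - gsum n m m' Q E E' (X t)).
Proof.
have Qc := cc (proj1 Qu).
have rhoc e j : iunit I e -> I 1%N (e - 1) -> (j < n)%N ->
    cubic I 2%N (fun t => rho Q e (X t) j - 1).
  move=> eu e1 jn; apply: cubic2_prod => i _.
  have i0n : (0 < i.+1 < n)%N by rewrite /= (leq_ltn_trans _ jn).
  exact: (theta_cubic Q0prim Q0I nat_unit Xc Qc X1 (fun=> Q1) i0n eu e1).
have : cubic I 2%N (fun t => \sum_(j < n) Q ^+ j *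
   (beta n m Q E (X t) j * beta n m' Q E' (X t) j
    * ((rho Q E (X t) j - 1) * rho Q E' (X t) j + (rho Q E' (X t) j - 1)))).
  apply: cubic_sum => j _.
  have r := rhoc E j Eu E1 (ltn_ord j); have r' := rhoc E' j E'u E'1 (ltn_ord j).
  have r'0 : cubic I 0%N (fun t => rho Q E' (X t) j).
    by apply: cubic_ext (cubicD (cubicW (cubicW r')) (cc (adic1 I))) => t; rewrite subrK.
  have b := beta_cubic Q0prim Q0I nat_unit Xc (cc (proj1 Eu)) Qc X1 (fun=> E1) (fun=> Q1)
    mn (ltn_ord j).
  have b' := beta_cubic Q0prim Q0I nat_unit Xc (cc (proj1 E'u)) Qc X1 (fun=> E'1) (fun=> Q1)
    m'n (ltn_ord j).
  have h1 := cubicM (cubicM b b') (cubicD (cubicM r r'0) r').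
  exact: cubicM (cubicX j Qc) h1.
apply: cubic_ext => t; rewrite -sumrB; apply: eq_bigr => j _; ring.
Qed.
End RhoCubic.

(** The factors [rho] are 1 up to order 2, so their effect on a difference in x has order 3. *)
Lemma rsum_diff : I 3%N ((rsum n m m' Q E E' x - rsum n m m' Q E E' 1)
                       - (gsum n m m' Q E E' x - gsum n m m' Q E E' 1)).
Proof.
pose X (t : cube 1) := if t.1 then x else 1.
have Xc : cubic I 0%N X by apply: (cubic_toggle 0); [case: xu|case: u1|].
have X1 t : I 1%N (X t - 1) by case: t => [[] t].
have [_ /= h] := rsum_cubic Xc X1.
by rewrite /X /= in h; move: h; congr (adic_ideal I 3%N _); ring.
Qed.

Lemma rsum_near : I 1%N (rsum n m m' Q E E' 1 - gsum n m m' Q E E' 1).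
Proof.
have := @rsum_cubic 0 (fun=> 1) (adic1 I) (fun=> rr 1%N 1).
exact: adicW.
Qed.

(** As [psi] - 1 is [cubic] of order 2, one toggle moving w to 1 and Q to Q0 together costs order 3.
    At (1, Q0) the product runs over the nontrivial roots of unity and [prod_prim1] evaluates it. *)
Lemma psi_near w : I 1%N (w - 1) ->
  I 3%N (psi n Q E w - qn n E ^+ 2 / (E ^+ n.-1 * n%:R ^+ 2)).
Proof.
move=> w1; have wu : iunit I w := iunit_close u1 w1.
have Ei0 := iunit_neq0 Eu.
have -> : qn n E ^+ 2 / (E ^+ n.-1 * n%:R ^+ 2) = psi n Q0 E 1.
  rewrite /psi /theta.
  have n1 : qn n (1 : F) = n%:R.
    by rewrite /qn (eq_bigr (fun=> 1)) ?sumr_const ?card_ord // => i _; rewrite expr1n.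
  have qV : qn n E^-1 = qn n E / E ^+ n.-1.
    rewrite /qn mulr_suml [LHS](reindex_inj rev_ord_inj) /=; apply: eq_bigr => i _.
    have -> : n.-1 = (n - i.+1 + i)%N by have h := ltn_ord i; clear -h; lia.
    by rewrite exprD invfM mulrCA mulfV ?expf_neq0 // mulr1 exprVn.
  transitivity ((qn n E / E ^+ n.-1) * (E ^+ n.-1 * qn n E^-1) / qn n 1 ^+ 2).
    rewrite n1 qV; field.
    by rewrite expf_neq0 ?(iunit_neq0 (nat_unit n0)).
  have EX : E ^+ n.-1 = \prod_(i < n.-1) E by rewrite prodr_const card_ord.
  rewrite EX -!(prod_prim1 Q0prim).
  rewrite -prodf_div -big_split -prodrXl -big_split -prodf_div /=; apply: eq_bigr => i _.
  by congr (_ * _ / _); rewrite !mul1r //; field.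
pose X (t : cube 1) := if t.1 then w else 1.
pose q (t : cube 1) := if t.1 then Q else Q0.
have Xc : cubic I 0%N X by apply: (cubic_toggle 0); [case: wu|case: u1|].
have X1 t : I 1%N (X t - 1) by case: t => [[] t].
have qc : cubic I 0%N q by apply: cubic_toggle; [case: Qu| |].
have q1 t : I 1%N (q t - Q0) by case: t => [[] t].
have : cubic I 2%N (fun t => psi n (q t) E (X t) - 1).
  apply: cubic2_prod => i _; apply: (theta_cubic Q0prim Q0I nat_unit) => //.
  by have h := ltn_ord i; clear -h; lia.
by case=> _ /=; rewrite opprB addrA subrK.
Qed.

End Differences.

(** * Taylor expansions to second order *)

Section Taylor.
Variables (F : fieldType) (I : adic F).
Hypothesis nat_unit : forall k, (0 < k)%N -> iunit I k%:R.

(** A logarithm to second order: s is additive in products and changes sign under inversion. *)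
Definition near1 u s := I 2%N s /\ I 3%N (u - (1 + s)).

Lemma near1_1 : near1 1 0.
Proof. by split; rewrite ?addr0 ?subrr; apply: adic0. Qed.

Lemma near1_I1 u s : near1 u s -> I 1%N (u - 1).
Proof.
case=> s2 us; have -> : u - 1 = (u - (1 + s)) + s by ring.
by apply: adicD; [apply: (adicWn (k := 3%N))|apply: (adicWn (k := 2%N))].
Qed.

Lemma near1_unit u s : near1 u s -> iunit I u.
Proof. by move=> /near1_I1 /(iunit_close (iunit1 I)). Qed.

Lemma near1M u v s r : near1 u s -> near1 v r -> near1 (u * v) (s + r).
Proof.
move=> us vr; have [s2 u3] := us; have [r2 v3] := vr.
split; first exact: adicD.
have -> : u * v - (1 + (s + r)) = (u - (1 + s)) * v + ((1 + s) * (v - (1 + r)) + s * r) by ring.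
apply: adicD; first by apply: adicMr => //; case: (near1_unit vr).
apply: adicD; last by apply: (adicWn (k := (2 + 2)%N)) => //; apply: adicM.
by apply: adicMl => //; apply: adicD; [exact: adic1|apply: (adicWn (k := 2%N))].
Qed.

Lemma near1V u s : near1 u s -> near1 u^-1 (- s).
Proof.
move=> us; have [s2 u3] := us; have uu := near1_unit us; have u0 := iunit_neq0 uu.
split; first exact: adicN.
have -> : u^-1 - (1 - s) = u^-1 * (s * s - (1 - s) * (u - (1 + s))) by field.
apply: adicMl; first exact: adic0V.
apply: adicB; first by apply: (adicWn (k := (2 + 2)%N)) => //; apply: adicM.
by apply: adicMl => //; apply: adicB; [exact: adic1|apply: (adicWn (k := 2%N))].
Qed.

Lemma near1_prod l (f : nat -> F) s :
  (forall k, near1 (f k) s) -> near1 (\prod_(k < l) f k) (l%:R * s).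
Proof.
move=> h; elim: l => [|l IH]; first by rewrite big_ord0 mul0r; exact: near1_1.
by rewrite big_ord_recr -natr1 mulrDl mul1r; apply: near1M.
Qed.

Lemma near1_eq u s s' : I 3%N (s - s') -> near1 u s -> near1 u s'.
Proof.
move=> ss [s2 u3]; split.
  have -> : s' = s - (s - s') by ring.
  by apply: adicB => //; apply: adicW.
have -> : u - (1 + s') = (u - (1 + s)) + (s - s') by ring.
exact: adicD.
Qed.

(** Divide u^2 - (1 + s)^2 by u + (1 + s), a unit because it is close to 2; closeness of u to 1
    selects the square root. *)
Lemma near1_sqrt u s : I 1%N (u - 1) -> I 2%N s -> near1 (u ^+ 2) (2 * s) -> near1 u s.
Proof.
move=> u1 s2 [_ h]; split=> //.
have us : iunit I (u + (1 + s)).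
  apply: iunit_close (nat_unit (ltn0Sn 1)) _.
  have -> : u + (1 + s) - 2%:R = (u - 1) + s by ring.
  by apply: adicD => //; apply: adicW.
have us0 := iunit_neq0 us.
have -> : u - (1 + s) = (u ^+ 2 - (1 + 2 * s) - s * s) / (u + (1 + s)) by field.
apply: adicMr; last exact: adic0V.
by apply: adicB => //; apply: (adicWn (k := (2 + 2)%N)) => //; apply: adicM.
Qed.

Variable e : F.
Hypothesis e1 : I 1%N e.

Lemma expr_jet k : I 3%N ((1 + e) ^+ k - (1 + k%:R * e + 'C(k, 2)%:R * e ^+ 2)).
Proof.
elim: k => [|k IH]; first by rewrite bin0n expr0 !mul0r !addr0 subrr; exact: adic0.
rewrite exprS binS bin1 natrD -natr1.
have -> : (1 + e) * (1 + e) ^+ k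
     - (1 + (k%:R + 1) * e + ('C(k, 2)%:R + k%:R) * e ^+ 2)
   = (1 + e) * ((1 + e) ^+ k - (1 + k%:R * e + 'C(k, 2)%:R * e ^+ 2))
     + 'C(k, 2)%:R * e ^+ 3 by ring.
apply: adicD; last by apply: adicMl; [exact: adic_nat|exact: adicXn].
by apply: adicMl => //; apply: adicD; [exact: adic1|exact: adicW].
Qed.

Lemma qn_jet k : I 3%N (qn k (1 + e) - (k%:R + 'C(k, 2)%:R * e + 'C(k, 3)%:R * e ^+ 2)).
Proof.
elim: k => [|k IH].
  by rewrite /qn big_ord0 !bin0n !mul0r !addr0 subrr; exact: adic0.
rewrite /qn big_ord_recr /= -/(qn k (1 + e)) !binS bin1 !natrD -natr1.
have := adicD IH (expr_jet k); congr (adic_ideal I 3%N _); ring.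
Qed.

Lemma nat_neq0 k : (0 < k)%N -> k%:R != 0 :> F.
Proof. by move=> /nat_unit /iunit_neq0. Qed.

Let two0 : 2%:R != 0 :> F. Proof. exact: nat_neq0. Qed.
Let three0 : 3%:R != 0 :> F. Proof. exact: nat_neq0. Qed.

Lemma bin2F k : 'C(k, 2)%:R = k%:R * (k%:R - 1) / 2 :> F.
Proof.
elim: k => [|k IH]; first by rewrite bin0n !mul0r.
by rewrite binS bin1 natrD IH -natr1; field.
Qed.

Lemma bin3F k : 'C(k, 3)%:R = k%:R * (k%:R - 1) * (k%:R - 2) / 6 :> F.
Proof.
have six0 : 6%:R != 0 :> F by apply: nat_neq0.
elim: k => [|k IH]; first by rewrite bin0n !mul0r.
by rewrite binS natrD IH bin2F -natr1; field; rewrite ?two0 ?three0 ?six0.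
Qed.

Lemma qn_unit k : (0 < k)%N -> iunit I (qn k (1 + e)).
Proof.
move=> k0; apply: iunit_close (nat_unit k0) _.
have -> : qn k (1 + e) - k%:R =
  (qn k (1 + e) - (k%:R + 'C(k, 2)%:R * e + 'C(k, 3)%:R * e ^+ 2))
  + ('C(k, 2)%:R * e + 'C(k, 3)%:R * e ^+ 2) by ring.
apply: adicD; first by apply: (adicWn (k := 3%N)) => //; exact: qn_jet.
apply: adicD; apply: adicMl => //; try exact: adic_nat.
by apply: (adicWn (k := 2%N)) => //; exact: adicXn.
Qed.

Definition nu k : F := (k%:R ^+ 2 - 1) / 12.

Lemma nuI k : I 0%N (nu k).
Proof.
apply: adicMl; last by apply: adic0V; exact: nat_unit.
by apply: adicB; [apply: adicX; exact: adic_nat|exact: adic1].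
Qed.

(** [k]_w^2 / w^(k-1) is invariant under w -> 1/w, which explains the missing first-order term. *)
Lemma qn_near1 k : (0 < k)%N ->
  near1 (qn k (1 + e) ^+ 2 / ((1 + e) ^+ k.-1 * k%:R ^+ 2)) (nu k * e ^+ 2).
Proof.
move=> k0; split; first by apply: adicMl; [exact: nuI|exact: adicXn].
have eu : iunit I (1 + e).
  by apply: iunit_close (iunit1 I) _; have -> : 1 + e - 1 = e by ring.
have ku := nat_unit k0.
have Du : iunit I ((1 + e) ^+ k.-1 * k%:R ^+ 2) by apply: iunitM; apply: iunitX.
set D := _ * _ in Du *.
have D0 := iunit_neq0 Du.
have -> : qn k (1 + e) ^+ 2 / D - (1 + nu k * e ^+ 2) =
   (qn k (1 + e) ^+ 2 - D * (1 + nu k * e ^+ 2)) / D by field.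
apply: adicMr; last exact: adic0V.
rewrite /D {D Du D0}.
set P := k%:R + 'C(k, 2)%:R * e + 'C(k, 3)%:R * e ^+ 2.
set R := 1 + k.-1%:R * e + 'C(k.-1, 2)%:R * e ^+ 2.
have hP := qn_jet k; have hR := expr_jet k.-1; rewrite -/P in hP; rewrite -/R in hR.
have e0 : I 0%N e by apply: adicW.
have P0 : I 0%N P.
  apply: adicD; first apply: adicD; first exact: adic_nat.
    by apply: adicMl => //; exact: adic_nat.
  by apply: adicMl; [exact: adic_nat|exact: adicX].
have q0 : I 0%N (qn k (1 + e)) by case: (qn_unit k0).
have n0' : I 0%N (k%:R ^+ 2 * (1 + nu k * e ^+ 2)).
  apply: adicMl; first by apply: adicX; exact: adic_nat.
  apply: adicD; first exact: adic1.
  by apply: adicMl; [exact: nuI|exact: adicX].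
(* c1 and c2 are the coefficients of e^3 and e^4 in P^2 - k^2 (1 + nu e^2) R; the lower ones
   cancel. *)
pose c1 := 2 * 'C(k, 2)%:R * 'C(k, 3)%:R - k%:R ^+ 2 * k.-1%:R * nu k.
pose c2 := 'C(k, 3)%:R ^+ 2 - k%:R ^+ 2 * nu k * 'C(k.-1, 2)%:R.
have -> : qn k (1 + e) ^+ 2 - (1 + e) ^+ k.-1 * k%:R ^+ 2 * (1 + nu k * e ^+ 2)
  = (qn k (1 + e) - P) * (qn k (1 + e) + P)
    - ((1 + e) ^+ k.-1 - R) * (k%:R ^+ 2 * (1 + nu k * e ^+ 2))
    + e ^+ 3 * (c1 + c2 * e).
  have twelve0 : 12%:R != 0 :> F by apply: nat_neq0.
  have six0 : 6%:R != 0 :> F by apply: nat_neq0.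
  have kE : k.-1%:R = k%:R - 1 :> F by rewrite -(prednK k0) -natr1 addrK.
  rewrite /c1 /c2 /P /R /nu !bin2F !bin3F kE.
  by field; rewrite ?two0 ?three0 ?six0 ?twelve0.
apply: adicD.
  apply: adicB; apply: adicMr => //.
  exact: adicD.
apply: adicMr; first exact: adicXn.
have N j := adic_nat I j; have nuk := nuI k.
apply: adicD; [|apply: adicMr => //]; apply: adicB.
- exact: adicMl (adicMl (N _) (N _)) (N _).
- exact: adicMl (adicMl (adicX _ (N _)) (N _)) nuk.
- exact: adicX.
- exact: adicMl (adicMl (adicX _ (N _)) nuk) (N _).
Qed.

End Taylor.

Section TaylorPower.
Variables (F : fieldType) (I : adic F) (t : F).
Hypothesis nat_unit : forall k, (0 < k)%N -> iunit I k%:R.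
Hypothesis t1 : I 1%N t.

Lemma expr_near A : I 1%N ((1 + t) ^+ A - 1).
Proof.
rewrite -[X in _ - X](expr1n _ A); apply: adicBX.
  by apply: adicD; [exact: adic1|exact: adicW].
by have -> : 1 + t - 1 = t by ring.
Qed.

(** Only the square of e = (1 + t)^A - 1 enters, so e may be replaced by its first-order part A
    t. *)
Lemma qn_expr_near1 A k : (0 < k)%N ->
  near1 I (qn k ((1 + t) ^+ A) ^+ 2 / (((1 + t) ^+ A) ^+ k.-1 * k%:R ^+ 2))
        (nu F k * (A%:R * t) ^+ 2).
Proof.
move=> k0; have e1 := expr_near A; set e := _ - 1 in e1.
have yE : (1 + t) ^+ A = 1 + e by rewrite /e addrCA subrr addr0.
rewrite yE.
apply: near1_eq (qn_near1 nat_unit e1 k0).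
have t0 : I 0%N t by exact: adicW.
rewrite -mulrBr; apply: adicMl; first exact: nuI.
rewrite subr_sqr; apply: (adicWn (k := (2 + 1)%N)) => //; apply: adicM.
  have -> : e - A%:R * t = ((1 + t) ^+ A - (1 + A%:R * t + 'C(A, 2)%:R * t ^+ 2))
     + 'C(A, 2)%:R * t ^+ 2 by rewrite yE; ring.
  apply: adicD; first by apply: adicW; exact: expr_jet.
  by apply: adicMl; [exact: adic_nat|exact: adicXn].
by apply: adicD => //; apply: adicMl => //; exact: adic_nat.
Qed.

(* Only the square of the ratio is a product of the even functions of
   [qn_expr_near1], hence the square root. *)
Lemma qn_ratio_near1 A B X k : (0 < k)%N ->
  near1 I (((1 + t) ^+ X) ^+ k.-1 * (qn k ((1 + t) ^+ A) * qn k ((1 + t) ^+ B))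
     / (qn k ((1 + t) ^+ (X + A)) * qn k ((1 + t) ^+ (X + B))))
   (- (nu F k * t ^+ 2 * (X%:R * (X + A + B)%:R))).
Proof.
move=> k0.
have hu C : iunit I (qn k ((1 + t) ^+ C)).
  have := qn_unit nat_unit (expr_near C) k0.
  by rewrite addrCA subrr addr0.
have hn C : I 1%N (qn k ((1 + t) ^+ C) - k%:R).
  rewrite /qn; have -> : k%:R = \sum_(i < k) (1 : F) by rewrite sumr_const card_ord.
  by apply: adicBsum => i _; rewrite -exprM; exact: expr_near.
have ku := nat_unit k0.
have yu : iunit I (1 + t).
  by apply: iunit_close (iunit1 I) _; have -> : 1 + t - 1 = t by ring.
have t2 : I 2%N (nu F k * t ^+ 2) by apply: adicMl; [exact: nuI|exact: adicXn].
apply: (near1_sqrt nat_unit).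
- set D := (X in _ / X - 1); set N := (X in X / D - 1).
  have Du : iunit I D by apply: iunitM.
  have -> : N / D - 1 = (N - D) / D by field; exact: iunit_neq0 Du.
  apply: adicMr; last exact: adic0V.
  apply: (adicB_trans (g := 1 * (k%:R * k%:R))).
    apply: adicBM.
    - exact: adic1.
    - by apply: adicMl; case: (hu A); case: (hu B).
    - by rewrite -exprM; exact: expr_near.
    - by apply: adicBM => //; [exact: adic_nat|case: (hu B)].
  rewrite mul1r; apply: adicBC; apply: adicBM => //; first exact: adic_nat.
  by case: (hu (X + B)%N).
- by apply: adicN; apply: adicMr => //; apply: adicMl; exact: adic_nat.
have h C := qn_expr_near1 C k0.
have := near1M (near1M (h A) (h B)) (near1V (near1M (h (X + A)%N) (h (X + B)%N))).
set u := (X in near1 I X _ -> _); set v := (X in _ -> near1 I X _).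
have -> : u = v.
  rewrite /u /v -!exprM !mulnDl !exprD.
  have hq C := iunit_neq0 (hu C); have hy C := iunit_neq0 (iunitX (C * k.-1) yu).
  have kk0 := iunit_neq0 ku.
  by field; rewrite -!exprD !hq !hy kk0.
(* A^2 + B^2 - (X + A)^2 - (X + B)^2 = - 2 X (X + A + B). *)
congr (near1 I v _); rewrite !natrD; ring.
Qed.
End TaylorPower.

(** * The block congruence *)

Definition cpair (F : fieldType) (d a b k : nat) (q : F) : F :=
  pair d a k q * pair d b k q * (q ^+ d) ^+ k.

Section BlockCongruence.
Variables (F : fieldType) (I : adic F) (n d : nat) (q z : F).
Variables (a b a' b' m m' : nat).
Hypothesis nat_unit : forall k, (0 < k)%N -> iunit I k%:R.
Hypothesis zprim : n.-primitive_root z.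
Hypothesis zI : I 0%N z.
Hypothesis qz : I 1%N (q - z).
Hypothesis q_inj : forall i j, q ^+ i = q ^+ j -> i = j.
Hypothesis nd : coprime n d.
Hypotheses (a0d : (0 < a < d)%N) (b0d : (0 < b < d)%N).
Hypotheses (a'0d : (0 < a' < d)%N) (b'0d : (0 < b' < d)%N).
Hypotheses (mn : (m < n)%N) (m'n : (m' < n)%N).
Hypothesis aE : (a + d * m = n * a')%N.
Hypothesis bE : (b + d * m' = n * b')%N.

Let Q := q ^+ d.
Let Q0 := z ^+ d.
Let y := q ^+ n.
Let t := y - 1.
Let E := q ^+ (n * a').
Let E' := q ^+ (n * b').

Let n0 : (0 < n)%N. Proof. exact: prim_order_gt0 zprim. Qed.
Let d0 : (0 < d)%N. Proof. by move: a0d; lia. Qed.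
Let zu : iunit I z. Proof. exact: prim_unit zprim zI. Qed.
Let qu : iunit I q. Proof. exact: iunit_close zu qz. Qed.
Let q0 : q != 0. Proof. exact: iunit_neq0 qu. Qed.
Let Q0prim : n.-primitive_root Q0.
Proof. by rewrite prim_root_exp_coprime // coprime_sym. Qed.
Let Q0I : I 0%N Q0. Proof. exact: adicX. Qed.
Let Q1 : I 1%N (Q - Q0). Proof. by apply: adicBX => //; case: qu. Qed.
Let t1 : I 1%N t.
Proof. by rewrite /t -(prim_expr_order zprim); apply: adicBX => //; case: qu. Qed.
Let yE : y = 1 + t. Proof. by rewrite /t addrCA subrr addr0. Qed.
Let y1 k : I 1%N (q ^+ (n * k) - 1).
Proof. by rewrite exprM -/y yE; exact: expr_near. Qed.
Let q_neq1 k : (0 < k)%N -> q ^+ k != 1.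
Proof. by move=> k0; apply/eqP; rewrite -(expr0 q) => /q_inj; lia. Qed.

Lemma cpair_block l j : (j < n)%N ->
  cpair d a b (l * n + j) q =
  cpair d a' b' l y
  * (\prod_(k < l) psi n Q E (Q ^+ (n * k)) * \prod_(k < l) psi n Q E' (Q ^+ (n * k)))
  / (beta n m Q E 1 0 * beta n m' Q E' 1 0)
  * (Q ^+ j * ((rho Q E (Q ^+ (n * l)) j * beta n m Q E (Q ^+ (n * l)) j)
               * (rho Q E' (Q ^+ (n * l)) j * beta n m' Q E' (Q ^+ (n * l)) j))).
Proof.
move=> jn; rewrite /cpair (pair_block n0 a0d a'0d mn aE q0 q_inj _ jn).
rewrite (pair_block n0 b0d b'0d m'n bE q0 q_inj _ jn) exprD.
have -> : (q ^+ d) ^+ (l * n) = (y ^+ d) ^+ l.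
  by rewrite -!exprM; congr (_ ^+ _); lia.
rewrite -?/Q -?/E -?/E' -?/y; move: (beta n m Q E 1 0) (beta n m' Q E' 1 0) => u v.
by rewrite invfM; ring.
Qed.

Lemma cpair_sum_block l : \sum_(j < n) cpair d a b (l * n + j) q =
  cpair d a' b' l y
  * (\prod_(k < l) psi n Q E (Q ^+ (n * k)) * \prod_(k < l) psi n Q E' (Q ^+ (n * k)))
  / (beta n m Q E 1 0 * beta n m' Q E' 1 0) * rsum n m m' Q E E' (Q ^+ (n * l)).
Proof. by rewrite /rsum mulr_sumr; apply: eq_bigr => j _; rewrite cpair_block. Qed.

(** All factors are close to 1 - Q0^i or 1 - Q0^-i with 0 < i < n, as [denom] omits i = 0 here. *)
Lemma beta_unit k e : (k < n)%N -> I 1%N (e - 1) -> iunit I (beta n k Q e 1 0).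
Proof.
move=> kn e1; have eu : iunit I e := iunit_close (iunit1 I) e1.
have Q0u := prim_unit Q0prim Q0I.
have Qu : iunit I Q := iunit_close Q0u Q1.
have near_lin i : (0 < i < n)%N -> forall v, I 1%N (v - Q0 ^+ i) -> iunit I (1 - v).
  move=> i0 v v1; apply: iunit_close (prim_unit1 Q0prim Q0I nat_unit i0) _.
  have -> : 1 - v - (1 - Q0 ^+ i) = - (v - Q0 ^+ i) by ring.
  exact: adicN.
have negl i : (0 < i < n)%N -> iunit I (1 - 1 * Q ^+ 0 * (Q ^- i * e)).
  move=> i0; rewrite expr0 mul1r mul1r.
  have i0' : (0 < n - i < n)%N by lia.
  apply: (near_lin _ i0').
  have -> : Q0 ^+ (n - i) = Q0 ^- i * 1.
    have Qi0 : Q0 ^+ i != 0 by rewrite expf_neq0 // (iunit_neq0 Q0u).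
    apply: (mulIf Qi0); rewrite mulr1 mulVf // -exprD subnK ?(prim_expr_order Q0prim) //.
    by move: i0; lia.
  apply: adicBM => //; try exact: adic1.
  - by apply: adic0V; apply: iunitX.
  - by case: eu.
  - by apply: adicBV; [apply: iunitX|apply: iunitX|apply: adicBX => //; case: Qu].
apply: iunitM; first apply: iunitM.
- apply: iunit_prod => i _; rewrite expr0 mul1r mul1r.
  apply: (near_lin i.+1); first by have := ltn_ord i; lia.
  rewrite -[Q0 ^+ _]mulr1 -invr1; apply: adicBM.
  + by apply: adicX.
  + exact: adic0V.
  + by apply: adicBX => //; case: Qu.
  + by apply: adicBV => //; exact: iunit1.
- rewrite big_nat_cond; apply: iunit_prod => i; rewrite andbT => hi.
  by apply: negl; lia.
- apply: iunitV; apply: iunit_prod => i i0; apply: negl.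
  by have := ltn_ord i; lia.
Qed.

(** [gsum_residue] needs the points Q^i and x Q^j to be distinct. For l > 0 the exponents of q
    differ, and at Q0 one compares n-th powers, x^n being different from 1. For l = 0 both sides
    coincide. *)
Lemma gsum_residues l (x := Q ^+ (n * l)) :
  gsum n m m' Q 1 x^-1 1 = gsum n m m' Q 1 x^-1 x /\
  gsum n m m' Q0 1 x^-1 1 = gsum n m m' Q0 1 x^-1 x.
Proof.
case: (posnP l) => [l0|l0]; first by rewrite /x l0 muln0 expr0.
have x0 : x != 0 by rewrite !expf_neq0.
have Q00 : Q0 != 0 := iunit_neq0 (prim_unit Q0prim Q0I).
split; apply: gsum_residue => //.
- exact: expf_neq0.
- move=> i j _ _ ij; apply: contra_neq ij; rewrite -!exprM => /q_inj /eqP.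
  by rewrite eqn_pmul2l // => /eqP.
- move=> i j ni nj; apply/eqP; rewrite /x -!exprM -exprD => /q_inj.
  by rewrite -mulnDr => /eqP; rewrite eqn_pmul2l //; move: d0 l0 ni nj; nia.
- move=> i j ni nj; apply: contra_neq => /eqP.
  by rewrite (eq_prim_root_expr Q0prim) !modn_small // => /eqP.
- move=> i j ni nj; apply/eqP => /(congr1 (fun v => v ^+ n)).
  rewrite exprMn -![(Q0 ^+ _) ^+ n]exprM ![(_ * n)%N]mulnC !exprM (prim_expr_order Q0prim).
  rewrite !expr1n mulr1 => /esym /eqP; apply/negP.
  by rewrite /x /Q -!exprM q_neq1 // !muln_gt0 d0 n0 l0.
Qed.

Let E1 : I 1%N (E - 1). Proof. exact: y1. Qed.
Let E'1 : I 1%N (E' - 1). Proof. exact: y1. Qed.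

Lemma gsum_I0 : I 0%N (gsum n m m' Q0 E E' 1).
Proof.
have g10 := @gsum_cubic F I n m m' Q0 Q0prim Q0I nat_unit mn m'n 0
  (fun=> 1) (fun=> E) (fun=> E') (fun=> Q0); apply: g10.
- exact: adic1.
- by case: (iunit_close (iunit1 I) E1).
- by case: (iunit_close (iunit1 I) E'1).
- exact: Q0I.
- by move=> _; rewrite subrr; exact: adic0.
- by [].
- by [].
- by move=> _; rewrite subrr; exact: adic0.
Qed.

Lemma rsum_gsum : I 1%N (rsum n m m' Q E E' 1 - gsum n m m' Q0 E E' 1).
Proof.
apply: (adicB_trans (g := gsum n m m' Q E E' 1)).
  exact: rsum_near Q0prim Q0I nat_unit mn m'n Q1 E1 E'1.
exact: gsum_near Q0prim Q0I nat_unit mn m'n Q1 E1 E'1.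
Qed.

(** The difference in x is carried over to [gsum] at Q0, where it is gsum(1) * (R - 1), the constant
    K having been absorbed. As R - 1 has order 2, gsum(1) is needed only to order 1, which lets
    [rsum] at Q take its place. *)
Lemma rsum_block l (x := Q ^+ (n * l)) :
  I 3%N (rsum n m m' Q E E' x - rsum n m m' Q E E' 1
     * (1 - nu F n * t ^+ 2 * ((d * l)%:R * (d * l + a' + b')%:R))).
Proof.
have x1 : I 1%N (x - 1) by rewrite /x -exprM mulnCA; apply: y1.
have [r1 r2] := gsum_residues l.
have h1 := rsum_diff Q0prim Q0I nat_unit mn m'n Q1 E1 E'1 x1.
have h2 := gsum_diff Q0prim Q0I nat_unit mn m'n Q1 E1 E'1 x1 r1 r2.
have h5 := rsum_gsum; have g10 := gsum_I0.
have [K KE] := gsum_prim E E' mn m'n Q0prim.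
have a'0 : (0 < a')%N by move: a'0d; lia.
have b'0 : (0 < b')%N by move: b'0d; lia.
have gx : gsum n m m' Q0 E E' x = K * (x ^+ n.-1 / (qn n (x * E) * qn n (x * E'))).
  apply: KE; rewrite /x /E /E' -exprM -exprD q_neq1 //; move: n0 a'0 b'0; nia.
have g1 : gsum n m m' Q0 E E' 1 = K * (1 / (qn n E * qn n E')).
  by rewrite KE ?expr1n !mul1r // /E /E' q_neq1 // muln_gt0 n0 ?a'0 ?b'0.
have yX k : q ^+ (n * k) = (1 + t) ^+ k by rewrite -yE exprM.
have := qn_ratio_near1 nat_unit t1 a' b' (d * l) n0.
have xE k : q ^+ (n * (d * l + k)) = x * q ^+ (n * k).
  by rewrite /x -exprM -exprD; congr (_ ^+ _); lia.
have xE0 : q ^+ (n * (d * l)) = x by rewrite /x -exprM; congr (_ ^+ _); lia.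
rewrite -!yX !xE xE0 -/E -/E'; set R := _ / _; set s := - _ => Rs.
have RE : gsum n m m' Q0 E E' x = gsum n m m' Q0 E E' 1 * R.
  rewrite gx g1 /R; have := yX a'; have := yX b'; rewrite -/E -/E' => hb ha.
  have e1 : qn n E != 0.
    have := qn_unit nat_unit E1 n0; rewrite addrCA subrr addr0; exact: iunit_neq0.
  have e2 : qn n E' != 0.
    have := qn_unit nat_unit E'1 n0; rewrite addrCA subrr addr0; exact: iunit_neq0.
  have w0 : qn n E * qn n E' != 0 by rewrite mulf_neq0.
  rewrite div1r; move: (qn n E * qn n E') w0 (_ * qn n (x * E'))^-1 => w w0 D.
  by rewrite -!mulrA; congr (K * _); rewrite mulrCA mulKf.
have [s2 R3] := Rs.
have e0 := adicD (adicD h1 h2) (adicD (adicMl g10 R3) (adicM (adicBC h5) s2)).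
move: e0; rewrite RE; congr (adic_ideal I 3 _); ring.
Qed.

Theorem cpair_congr l : I 0%N (cpair d a' b' l y) ->
  I 3%N (\sum_(j < n) cpair d a b (l * n + j) q
    - (\sum_(j < n) cpair d a b j q)
      * (cpair d a' b' l y
         * (1 - nu F n * t ^+ 2
                * ((d * l) ^ 2 + l * (a' * (d - a') + b' * (d - b')))%:R))).
Proof.
move=> c0; have yX k : q ^+ (n * k) = (1 + t) ^+ k by rewrite -yE exprM.
have h0 := cpair_sum_block 0; rewrite muln0 expr0 !big_ord0 mulr1 in h0.
have c00 : cpair d a' b' 0 y = 1.
  by rewrite /cpair /pair /qpoch !big_ord0 !(expr0, mulr1, expr1n, invr1).
have -> : \sum_(j < n) cpair d a b j q =
  rsum n m m' Q E E' 1 / (beta n m Q E 1 0 * beta n m' Q E' 1 0).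
  by rewrite -[LHS]/(\sum_(j < n) cpair d a b (0 * n + j) q) h0 c00 mul1r div1r mulrC.
rewrite cpair_sum_block.
have psi1 c :
    near1 I (\prod_(k < l) psi n Q (q ^+ (n * c)) (Q ^+ (n * k))) (l%:R * (nu F n * (c%:R * t) ^+ 2)).
  pose f k := psi n Q (q ^+ (n * c)) (Q ^+ (n * k)).
  apply: (@near1_prod F I l f) => k; rewrite /f.
  have [r2 r3] := qn_expr_near1 nat_unit t1 c n0; split=> //.
  have e1 : I 1%N (q ^+ (n * c) - 1) by apply: y1.
  have w1 : I 1%N (Q ^+ (n * k) - 1) by rewrite -exprM mulnCA; apply: y1.
  have h := psi_near Q0prim Q0I nat_unit Q1 e1 w1.
  by apply: (adicB_trans h); rewrite yX; exact: r3.
have pp := near1M (psi1 a') (psi1 b'); rewrite -/E -/E' in pp.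
move: pp; set P := _ * _; set s := _ + _ => pp.
have rl := rsum_block l; move: rl; set r := rsum n m m' Q E E' (Q ^+ (n * l)).
set r1 := rsum n m m' Q E E' 1.
set u := nu F n * t ^+ 2 * _ => rl.
have u2 : I 2%N (- u).
  apply: adicN; apply: adicMr; last by apply: adicMl; exact: adic_nat.
  by apply: adicMl; [exact: nuI|exact: adicXn].
have r10 : I 0%N r1.
  have -> : r1 = (r1 - gsum n m m' Q0 E E' 1) + gsum n m m' Q0 E E' 1 by rewrite subrK.
  by apply: adicD; [apply: adicW; exact: rsum_gsum|exact: gsum_I0].
have bb : I 0%N (beta n m Q E 1 0 * beta n m' Q E' 1 0)^-1.
  by apply: adic0V; apply: iunitM; apply: beta_unit.
move: bb; set bb := _^-1 => bb0.
have u1 : near1 I (1 - u) (- u) by split=> //; rewrite subrr; exact: adic0.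
have [_ h] := near1M pp u1.
(* In units of nu t^2, [psi] contributes l (a'^2 + b'^2) and [rsum] contributes - d l (d l + a' +
   b'). *)
have -> : 1 - nu F n * t ^+ 2 * ((d * l) ^ 2 + l * (a' * (d - a') + b' * (d - b')))%:R
   = 1 + (s - u).
  have a'd : (a' <= d)%N by move: a'0d; lia.
  have b'd : (b' <= d)%N by move: b'0d; lia.
  rewrite /s /u !(natrD, natrM, natrX) !natrB //; ring.
have P0 : I 0%N P by case: (near1_unit pp).
have := adicMl (adicMl c0 bb0) (adicD (adicMl P0 rl) (adicMl r10 h)).
congr (adic_ideal I 3 _); rewrite -/r; ring.
Qed.

End BlockCongruence.

(** * Localization at a root of unity *)

Notation fracp p := (@FracField.tofrac _ p).

Section Localization.
Variables (K : fieldType) (z : K).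
Implicit Types p r : {poly K}.

Definition order_ge k (f : {fraction {poly K}}) : Prop :=
  exists a b : {poly K}, b.[z] != 0 /\ f = fracp (('X - z%:P) ^+ k * a) / fracp b.

Lemma horner_neq0 p : p.[z] != 0 -> fracp p != 0.
Proof. by rewrite tofrac_eq0; apply: contraNneq => ->; rewrite horner0. Qed.

Lemma order_ge0 k : order_ge k 0.
Proof. by exists 0, 1; rewrite hornerC oner_neq0 mulr0 tofrac0 mul0r. Qed.

Lemma order_ge1 : order_ge 0 1.
Proof. by exists 1, 1; rewrite hornerC oner_neq0 expr0 mulr1 tofrac1 divr1. Qed.

Lemma order_geD k f g : order_ge k f -> order_ge k g -> order_ge k (f + g).
Proof.
move=> [a [b [b0 ->]]] [a' [b' [b'0 ->]]]; exists (a * b' + a' * b), (b * b').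
split; first by rewrite hornerM mulf_neq0.
by rewrite addf_div ?horner_neq0 // -!tofracM -tofracD; congr (fracp _ / _); ring.
Qed.

Lemma order_geN k f : order_ge k f -> order_ge k (- f).
Proof.
by move=> [a [b [b0 ->]]]; exists (- a), b; split=> //; rewrite mulrN tofracN mulNr.
Qed.

Lemma order_geM k l f g : order_ge k f -> order_ge l g -> order_ge (k + l) (f * g).
Proof.
move=> [a [b [b0 ->]]] [a' [b' [b'0 ->]]]; exists (a * a'), (b * b').
split; first by rewrite hornerM mulf_neq0.
by rewrite mulf_div -!tofracM exprD; congr (fracp _ / _); ring.
Qed.

Lemma order_geW k f : order_ge k.+1 f -> order_ge k f.
Proof.
move=> [a [b [b0 ->]]]; exists (('X - z%:P) * a), b; split=> //.
by rewrite exprSr mulrA.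
Qed.

Lemma order_geV f : order_ge 0 f -> ~ order_ge 1 f -> order_ge 0 f^-1.
Proof.
move=> [a [b [b0 ->]]] h; exists b, a; rewrite !expr0 !mul1r; split; last by rewrite invf_div.
apply/negP => az; apply: h; have /factor_theorem[c ac] : root a z by [].
by exists c, b; rewrite expr0 expr1 mul1r ac [c * _]mulrC.
Qed.

Lemma order_ge1_frac p : p.[z] != 0 -> ~ order_ge 1 (fracp p).
Proof.
move=> p0 [a [b [b0 e]]]; have /eqP := congr1 (fun g => g * fracp b) e.
rewrite divfK ?horner_neq0 // -tofracM tofrac_eq expr1 => /eqP /(congr1 (fun r => r.[z])).
rewrite !hornerM hornerXsubC subrr mul0r => /eqP.
by rewrite mulf_eq0 (negbTE p0) (negbTE b0).
Qed.

Lemma order_ge1N1 : ~ order_ge 1 1.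
Proof. by rewrite -tofrac1; apply: order_ge1_frac; rewrite hornerC oner_neq0. Qed.

Definition localization := Adic order_ge0 order_ge1 order_geD order_geN order_geM
  order_geW order_geV order_ge1N1.

Lemma localization_frac p : localization 0%N (fracp p).
Proof. by exists p, 1; rewrite hornerC oner_neq0 expr0 mul1r tofrac1 divr1. Qed.

Lemma localization_unit p : p.[z] != 0 -> iunit localization (fracp p).
Proof. by move=> p0; split; [exact: localization_frac|exact: order_ge1_frac]. Qed.

Lemma localization_X : localization 1%N (fracp 'X - fracp z%:P).
Proof. by exists 1, 1; rewrite hornerC oner_neq0 expr1 mulr1 tofrac1 divr1 tofracB. Qed.

End Localization.

(** * From the order at z to congruences modulo powers of the cyclotomic polynomial *)

Notation intrp := (map_poly (intr : int -> algC)).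

Section Transfer.
Variables (n : nat) (z : algC).
Hypothesis zprim : n.-primitive_root z.

(** Division by the monic ['Phi_n] stays in Z[q]; the remainder vanishes at z and has smaller degree
    than the minimal polynomial of z. *)
Lemma Cyclotomic_dvd (p : {poly int}) : (intrp p).[z] = 0 -> exists s, p = s * 'Phi_n.
Proof.
move=> pz; have mon := Cyclotomic_monic n.
exists (Pdiv.Ring.rdivp p 'Phi_n); rewrite {1}(Pdiv.RingMonic.rdivp_eq mon p).
set r := Pdiv.Ring.rmodp _ _; suff -> : r = 0 by rewrite addr0.
have szr : (size r < size 'Phi_n)%N by rewrite Pdiv.Ring.ltn_rmodpN0 ?monic_neq0.
have := pz; rewrite {1}(Pdiv.RingMonic.rdivp_eq mon p) rmorphD rmorphM /= hornerD hornerM.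
have Phiz : root (intrp 'Phi_n) z by rewrite (Cintr_Cyclotomic zprim) root_cyclotomic.
rewrite (rootP Phiz) mulr0 add0r -/r => rz.
have [P [PE Pmon Pdvd]] := minCpolyP z.
have rQ : intrp r = map_poly ratr (map_poly (intr : int -> rat) r).
  by rewrite -map_poly_comp; apply: eq_map_poly => i /=; rewrite ratr_int.
have : root (map_poly ratr (map_poly (intr : int -> rat) r)) z by rewrite -rQ; apply/rootP.
rewrite Pdvd => dv; apply/eqP; apply: contraTT szr => r0.
rewrite -leqNgt; have szP : size P = size 'Phi_n.
  rewrite -(size_map_poly (ratr : {rmorphism rat -> algC})) -PE.
  rewrite (minCpoly_cyclotomic zprim) -(Cintr_Cyclotomic zprim).
  by rewrite size_map_inj_poly //; exact: intr_inj.
have szr' : size (map_poly (intr : int -> rat) r) = size r.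
  by rewrite size_map_inj_poly //; exact: intr_inj.
rewrite -szP -szr'.
by apply: dvdp_leq dv; rewrite map_poly_eq0_id0 // intr_eq0 lead_coef_eq0.
Qed.

Lemma Cyclotomic_simple : exists2 w, intrp 'Phi_n = ('X - z%:P) * w & w.[z] != 0.
Proof.
rewrite (Cintr_Cyclotomic zprim) /cyclotomic.
case: (ltngtP n 1) => [n0|n1|n1].
- by have := prim_order_gt0 zprim; move: n0; case: n.
- rewrite (bigD1 (Ordinal n1)) /= ?coprime1n // expr1; eexists; first by [].
  rewrite horner_prod; apply/prodf_neq0 => i /andP[_ i1].
  rewrite hornerXsubC subr_eq0 -{1}[z]expr1 (eq_prim_root_expr zprim) !modn_small //.
  by rewrite eq_sym.
- have z1 : z = 1 by have := prim_expr_order zprim; rewrite n1 expr1.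
  rewrite n1 big_mkcond big_ord_recl big_ord0 /= expr0 z1; exists 1 => //.
  by rewrite hornerC oner_neq0.
Qed.

Lemma Cyclotomic_exp_dvd k (p : {poly int}) (u v : {poly algC}) : v.[z] != 0 ->
  intrp p * v = ('X - z%:P) ^+ k * u -> exists s, p = s * 'Phi_n ^+ k.
Proof.
elim: k p u v => [|k IH] p u v v0 E; first by exists p; rewrite expr0 mulr1.
have pz : (intrp p).[z] = 0.
  have /eqP := congr1 (fun r => r.[z]) E.
  rewrite !hornerM exprS hornerM hornerXsubC subrr !mul0r mulf_eq0 (negbTE v0) orbF.
  by move=> /eqP.
have [s sE] := Cyclotomic_dvd pz; have [w wE w0] := Cyclotomic_simple.
have /IH[|s' s'E] : intrp s * (w * v) = ('X - z%:P) ^+ k * u.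
- have /mulfI : 'X - z%:P != 0 by rewrite polyXsubC_eq0.
  apply; rewrite [RHS]mulrA -exprS -E sE rmorphM /= wE; ring.
- by rewrite hornerM mulf_neq0.
by exists s'; rewrite sE s'E exprSr mulrA.
Qed.

(** A fraction given by [related] need not be reduced; splitting off the powers of ['Phi_n] yields
    the coprime denominator that [congr0] asks for. *)
Lemma Cyclotomic_part (b : {poly int}) : b != 0 ->
  exists k b', b = b' * 'Phi_n ^+ k /\ (intrp b').[z] != 0.
Proof.
elim: {b}_.+1 {-2}b (ltnSn (size b)) => // N IH b szb b0.
case: (eqVneq (intrp b).[z] 0) => [bz|bz]; last by exists 0%N, b; rewrite expr0 mulr1.
have [s sE] := Cyclotomic_dvd bz.
have s0 : s != 0 by apply: contraNneq b0 => s0; rewrite sE s0 mul0r.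
have szs : (size s < N)%N.
  apply: leq_trans (_ : (size s).+1 <= size b)%N _ => //.
  rewrite sE size_Mmonic ?Cyclotomic_monic // size_Cyclotomic addnS /=.
  rewrite -addn1 leq_add2l totient_gt0; exact: prim_order_gt0 zprim.
have [k [b' [b'E b'0]]] := IH s szs s0.
by exists k.+1, b'; rewrite sE b'E -mulrA -exprSr.
Qed.

(** A common divisor d does not vanish at z, since b does not. Hence its cofactor in a multiple of
    ['Phi_n] does, is itself divisible by ['Phi_n], and d is constant. The integers c and c' reflect
    divisibility up to integer factors. *)
Lemma Cyclotomic_coprime k (b : {poly int}) : (intrp b).[z] != 0 ->
  coprimep ('Phi_n ^+ k) b.
Proof.
move=> bz; apply: coprimep_expl; apply/coprimepP => d.
move=> /Pdiv.Idomain.dvdpP[[c r] /= c0 cE] /Pdiv.Idomain.dvdpP[[c' r'] /= c'0 c'E].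
have ev (e : int) (p : {poly int}) : (intrp (e *: p)).[z] = e%:~R * (intrp p).[z].
  by rewrite map_polyZ hornerZ.
have dz : (intrp d).[z] != 0.
  apply/eqP => d0; have := ev c' b; rewrite c'E rmorphM hornerM /= d0 mulr0 => /esym/eqP.
  by rewrite mulf_eq0 intr_eq0 (negbTE c'0) (negbTE bz).
have Phiz : (intrp 'Phi_n).[z] = 0.
  by apply/rootP; rewrite (Cintr_Cyclotomic zprim) root_cyclotomic.
have /Cyclotomic_dvd[s sE] : (intrp r).[z] = 0.
  have := ev c 'Phi_n; rewrite cE rmorphM hornerM /= Phiz mulr0 => /eqP.
  by rewrite mulf_eq0 (negbTE dz) orbF => /eqP.
have cd : c%:P = s * d.
  have /mulfI : 'Phi_n != 0 :> {poly int} by rewrite monic_neq0 ?Cyclotomic_monic.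
  by apply; rewrite mulrC mul_polyC cE sE; ring.
rewrite -size_poly_eq1; have := congr1 (fun p : {poly int} => size p) cd.
have cP : c%:P != 0 :> {poly int} by rewrite polyC_eq0.
have := cP; rewrite {1}cd mulf_eq0 negb_or => /andP[s0 d0].
rewrite size_polyC c0 size_mul // => e.
move: (s0) (d0) e; rewrite -!size_poly_gt0; move: (size s) (size d) => u v; lia.
Qed.

(** The graph of the embedding of Z(q) into algC(q), encoded by a common integral fraction. *)
Definition related (f : ratfun) (g : {fraction {poly algC}}) : Prop :=
  exists a b : {poly int}, [/\ b != 0, f = a%:F / b%:F & g = fracp (intrp a) / fracp (intrp b)].

Lemma related_congr0 k f g : related f g -> localization z k g -> congr0 ('Phi_n ^+ k) f.
Proof.
move=> [a [b [b0 -> ->]]] [u [v [v0]]].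
have bI : intrp b != 0 by rewrite map_poly_eq0_id0 // intr_eq0 lead_coef_eq0.
have [j [b' [bE b'0]]] := Cyclotomic_part b0.
have [w wE w0] := Cyclotomic_simple.
move=> /eqP; rewrite eqr_div ?tofrac_eq0 //; last by apply: contraNneq v0 => ->; rewrite horner0.
rewrite -!tofracM tofrac_eq => /eqP E.
have [||s sE] := @Cyclotomic_exp_dvd (k + j) a (u * w ^+ j * intrp b') v.
- by [].
- by rewrite E bE rmorphM rmorphXn /= wE exprMn exprD; ring.
have P0 : 'Phi_n ^+ j != 0 :> {poly int} by rewrite expf_neq0 // monic_neq0 ?Cyclotomic_monic.
have b'n0 : b' != 0 by apply: contraNneq b'0 => ->; rewrite rmorph0 horner0.
exists (s * 'Phi_n ^+ k), b'; split=> //; last exact: Cyclotomic_coprime.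
- by rewrite sE bE exprD mulrA !tofracM -mulf_div divff ?mulr1 ?tofrac_eq0.
- by exists s.
Qed.

End Transfer.

(** * Nonvanishing of the first block *)

Lemma ex_max_real (T : eqType) (f : T -> algC) (s : seq T) (x0 : T) :
  (forall x, f x \is Num.real) -> x0 \in s ->
  exists2 x, x \in s & forall y, y \in s -> f y <= f x.
Proof.
move=> fR; elim: s x0 => // a s IH x0 _.
case: s IH => [|b s] IH; first by exists a; rewrite ?inE // => y; rewrite inE => /eqP->.
have [x xs xmax] := IH b (mem_head b s).
have [le|lt] := real_leP (fR a) (fR x).
  exists x; first by rewrite inE xs orbT.
  by move=> y; rewrite inE => /predU1P[->|/xmax].
exists a; first exact: mem_head.
move=> y; rewrite inE => /predU1P[->|/xmax] // h.
exact: le_trans h (ltW lt).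
Qed.

Section UnitCircle.
Implicit Types u v w : algC.

Lemma unit_circle u : u * u^* = 1 -> 'Re u ^+ 2 + 'Im u ^+ 2 = 1.
Proof. by move=> <-; rewrite -normCK normC2_Re_Im. Qed.

Lemma Im_mul_conj u v : 'Im (u * v^* ) = 'Im u * 'Re v - 'Re u * 'Im v.
Proof. rewrite ImM Re_conj Im_conj; ring. Qed.

(** For u = exp(i alpha) and v = exp(i beta) on the upper half circle, sin(alpha - beta) > 0 means
    alpha > beta, and the cosine decreases. The identity E is sin(alpha - beta) sin(alpha + beta) =
    cos(beta)^2 - cos(alpha)^2. *)
Lemma unit_circle_Re_lt u v : u * u^* = 1 -> v * v^* = 1 ->
  0 < 'Im u -> 0 <= 'Im v -> 0 < 'Im (u * v^* ) -> 'Re u < 'Re v.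
Proof.
move=> /unit_circle u1 /unit_circle v1 y0 t0; rewrite Im_mul_conj.
have [xR yR] := (Creal_Re u, Creal_Im u); have [sR tR] := (Creal_Re v, Creal_Im v).
move: ('Re u) ('Im u) ('Re v) ('Im v) xR yR sR tR u1 v1 y0 t0 => x y s t xR yR sR tR u1 v1 y0 t0 h.
rewrite real_ltNge //; apply/negP => sx.
have E : (y * s - x * t) * (y * s + x * t) = s ^+ 2 - x ^+ 2.
  have -> : s ^+ 2 - x ^+ 2 = s ^+ 2 * (x ^+ 2 + y ^+ 2) - x ^+ 2 * (s ^+ 2 + t ^+ 2).
    by rewrite u1 v1 !mulr1.
  ring.
have [s0|s0] := real_ge0P sR.
  have x0 : 0 <= x := le_trans s0 sx.
  have : 0 <= s ^+ 2 - x ^+ 2.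
    by rewrite -E; apply: mulr_ge0; [exact: ltW|rewrite addr_ge0 ?mulr_ge0 // ltW].
  rewrite subr_ge0 ler_pXn2r ?nnegrE // => xs.
  have xs' : x = s by apply/le_anti; rewrite xs sx.
  move: v1; rewrite -u1 -xs' => /addrI /eqP; rewrite eqrXn2 // ?ltW // => /eqP ty.
  by move: h; rewrite -xs' ty mulrC subrr ltxx.
have ys : y * s < 0 by rewrite pmulr_rlt0.
have xt : x * t < 0 by apply: lt_trans ys; rewrite -subr_gt0.
have x0 : x < 0.
  rewrite real_ltNge ?real0 //; apply/negP => x0.
  by have := mulr_ge0 x0 t0; rewrite (lt_geF xt).
have : s ^+ 2 - x ^+ 2 < 0 by rewrite -E pmulr_rlt0 // addrC; apply: lt_trans ys; rewrite gtrDr.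
rewrite subr_lt0 -[s ^+ 2]sqrrN -[x ^+ 2]sqrrN ltr_pXn2r ?nnegrE ?oppr_ge0 ?ltW //.
by rewrite ltrN2 => /lt_geF; rewrite sx.
Qed.

Lemma real_unit_circle u : u * u^* = 1 -> 'Im u = 0 -> u = 1 \/ u = -1.
Proof.
move=> u1 u0; have := unit_circle u1; rewrite u0 expr0n addr0 => /eqP.
rewrite sqrf_eq1 => h; rewrite [u]Crect u0 mulr0 addr0.
by case/orP: h => /eqP; [left|right].
Qed.
End UnitCircle.

(* z = exp (i pi / n), obtained as the element with the largest real part among
   the 2n-th roots of unity other than 1 in the closed upper half plane. *)
Lemma ex_sines n : (1 < n)%N -> exists z : algC,
  [/\ z != 0, z^-1 = z^*, n.-primitive_root (z ^+ 2) &
      forall a, (0 < a < n)%N -> 0 < 'Im (z ^+ a)].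
Proof.
move=> n1; have n20 : (0 < n.*2)%N by rewrite double_gt0; lia.
have ImN u : 'Im (- u) = - 'Im u :> algC by rewrite raddfN.
have [p pp Imp] : exists2 p : algC, n.*2.-primitive_root p & 0 <= 'Im p.
  have [p pp] := C_prim_root_exists n20.
  have [Imp|Imp] := real_leP (real0 _) (Creal_Im p); first by exists p.
  exists p^*; first by rewrite fmorph_primitive_root.
  by rewrite Im_conj oppr_ge0 ltW.
have U1 (u : algC) : u ^+ n.*2 = 1 -> u * u^* = 1.
  move=> un; have /eqP : `|u| ^+ n.*2 = 1 by rewrite -normrX un normr1.
  by rewrite -normCK pexpr_eq1 // => /eqP ->; rewrite expr1n.
pose cand := [seq u <- [seq p ^+ i | i <- iota 0 n.*2] | (u != 1) && (0 <= 'Im u)].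
have candP u : (u \in cand) = [&& u ^+ n.*2 == 1, u != 1 & 0 <= 'Im u].
  rewrite mem_filter andbC; congr (_ && _); apply/mapP/eqP => [[i _ ->]|/(prim_rootP pp)[i ->]].
    by rewrite -exprM mulnC exprM (prim_expr_order pp) expr1n.
  by exists (val i) => //; rewrite mem_iota add0n ltn_ord.
have N1 : (-1 : algC) ^+ n.*2 = 1 by rewrite -mul2n exprM sqrrN !expr1n.
have Im1 : 'Im (1 : algC) = 0 by apply/Creal_ImP; rewrite real1.
have ImN1 : 'Im (-1 : algC) = 0 by rewrite ImN Im1 oppr0.
have cN1 : -1 \in cand.
  by rewrite candP N1 eqxx ImN1 lexx andbT eq_sym -addr_eq0 (_ : 1 + 1 = 2%:R) ?pnatr_eq0.
have [z zc zmax] := ex_max_real (fun u => Creal_Re u) cN1.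
move: zc; rewrite candP => /and3P[/eqP zn z1 Imz0].
have p_sqr : p ^+ 2 != 1.
  by rewrite -(prim_order_dvd pp); apply/negP => /dvdn_leq; lia.
have pn : p ^+ n.*2 = 1 := prim_expr_order pp.
have Im_p : 0 < 'Im p.
  rewrite lt_def Imp andbT; apply: contra_neq p_sqr => p0.
  by case: (real_unit_circle (U1 _ pn) p0) => ->; rewrite ?sqrrN expr1n.
have Imz : 0 < 'Im z.
  rewrite lt_def Imz0 andbT; apply/eqP => z0.
  case: (real_unit_circle (U1 _ zn) z0) => zE; first by rewrite zE eqxx in z1.
  have pc : p \in cand.
    rewrite candP pn eqxx Imp andbT /=; apply: contra_neq p_sqr => ->; exact: expr1n.
  have := zmax _ pc; rewrite zE raddfN /= (Creal_ReP _ (real1 _)) lerNr => h.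
  have : 1 <= (- 'Re p) ^+ 2 by rewrite exprn_ege1.
  rewrite sqrrN -(unit_circle (U1 _ pn)) gerDl => h2.
  have : 0 < 'Im p ^+ 2 by rewrite exprn_gt0.
  by move=> /lt_geF; rewrite h2.
have z0 : z != 0 by apply: contraTneq Imz => ->; rewrite raddf0 ltxx.
have zV : z^-1 = z^* by apply: (mulfI z0); rewrite U1 // mulfV.
(* By maximality of 'Re z, no candidate lies strictly between 1 and z on the upper arc. *)
have C1 u : u ^+ n.*2 = 1 -> 0 <= 'Im u -> 0 < 'Im (z * u^* ) -> u = 1.
  move=> un Imu Imzu; apply/eqP; apply/negP => /negP u1.
  have := unit_circle_Re_lt (U1 _ zn) (U1 _ un) Imz Imu Imzu.
  by move=> /lt_geF; rewrite zmax // candP un eqxx u1.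
have nposP u : ~~ (0 < 'Im u) -> 'Im u <= 0 by rewrite -real_leNgt ?real0 ?Creal_Im.
have exa : exists a, (0 < a)%N && ~~ (0 < 'Im (z ^+ a)).
  by exists n.*2; rewrite n20 zn Im1 ltxx.
case: (ex_minnP exa) => a /andP[a0 /nposP Ima] amin.
have Impos i : (0 < i < a)%N -> 0 < 'Im (z ^+ i).
  case/andP=> i0 ia; apply/negPn/negP => h.
  by have := amin i; rewrite i0 h => /(_ isT); rewrite leqNgt ia.
(* Here a is the first exponent at which the powers of z leave the open upper half plane. Then u = -
   z^a has a smaller angle than z, because z / u = - z^(1-a) has positive imaginary part; so u =
   1. *)
have za : z ^+ a = -1.
  apply: oppr_inj; rewrite opprK; apply: C1.
  - by rewrite exprNn N1 mul1r -exprM mulnC exprM zn expr1n.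
  - by rewrite ImN oppr_ge0.
  have a1 : (1 < a)%N.
    by rewrite ltn_neqAle a0 andbT; apply: contraTneq Ima => <-; rewrite expr1 (lt_geF Imz).
  rewrite -(prednK a0) exprS rmorphN rmorphM /= -zV mulrN mulrA mulfV // mul1r.
  by rewrite ImN Im_conj opprK Impos //; move: a1; lia.
(* Divide u by z until the quotient leaves the open upper half plane; the last quotient v inside
   must be z. *)
have pow u : u ^+ n.*2 = 1 -> 0 < 'Im u -> exists b, u = z ^+ b.
  move=> un Imu.
  have exb : exists b, ~~ (0 < 'Im (u / z ^+ b)).
    by exists a; rewrite za invrN1 mulrN1 ImN oppr_gt0 (lt_gtF Imu).
  case: (ex_minnP exb) => b /nposP Imb bmin.
  have b0 : (0 < b)%N.
    by rewrite lt0n; apply: contraTneq Imb => ->; rewrite expr0 divr1 (lt_geF Imu).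
  pose v := u / z ^+ b.-1.
  have vz : v / z = u / z ^+ b by rewrite /v -[in RHS](prednK b0) exprSr invfM mulrA.
  have Imv : 0 < 'Im v.
    by apply/negPn/negP => /bmin; rewrite -ltnS prednK // ltnn.
  have vn : v ^+ n.*2 = 1.
    by rewrite expr_div_n un -exprM mulnC exprM zn expr1n divr1.
  have Imzv : 'Im (z * v^* ) = - 'Im (v / z).
    by rewrite -Im_conj zV [(_ * _)^*]rmorphM /= conjCK mulrC.
  rewrite -vz in Imb.
  have [h|h] := eqVneq ('Im (v / z)) 0; last first.
    have v1 : v = 1.
      apply: C1 => //; first exact: ltW.
      by rewrite Imzv oppr_gt0 lt_def eq_sym h.
    by move: Imv; rewrite v1 Im1 ltxx.
  exists b; apply: (mulIf (invr_neq0 (expf_neq0 b z0))); rewrite mulfV ?expf_neq0 // -vz.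
  have vzn : (v / z) ^+ n.*2 = 1 by rewrite expr_div_n vn zn divr1.
  case: (real_unit_circle (U1 _ vzn) h) => // vzN.
  move: Imv; rewrite -(divfK z0 v) vzN mulN1r ImN oppr_gt0 => /lt_gtF.
  by rewrite Imz.
(* The primitive 2n-th root p is a power of z, so z^(2a) = 1 forces 2n | 2a. *)
have an : (n <= a)%N.
  have [b pb] := pow p pn Im_p.
  have : p ^+ a.*2 = 1.
    have za2 : z ^+ a.*2 = 1 by rewrite -mul2n mulnC exprM za sqrrN expr1n.
    by rewrite pb -exprM mulnC exprM za2 expr1n.
  move=> /eqP; rewrite -(prim_order_dvd pp) => /dvdn_leq; rewrite double_gt0 leq_double.
  exact.
have Im_gt0 i : (0 < i < n)%N -> 0 < 'Im (z ^+ i).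
  by move=> /andP[i0 ni]; apply: Impos; rewrite i0 (leq_trans ni an).
exists z; split=> //.
have z2n : (z ^+ 2) ^+ n = 1 by rewrite -exprM mul2n.
have [k kp kn] := prim_order_exists (ltnW n1) z2n.
have k0 := prim_order_gt0 kp.
have kn' : (k <= n)%N by apply: dvdn_leq kn; exact: ltnW.
suff kE : k = n by rewrite -kE.
apply/eqP; rewrite eqn_leq kn' leqNgt; apply/negP => lt.
have := Im_gt0 k; rewrite k0 lt => /(_ isT).
have : (z ^+ k) ^+ 2 = 1 by rewrite -exprM mulnC exprM (prim_expr_order kp).
by move=> /eqP; rewrite sqrf_eq1 => /orP[] /eqP ->; rewrite ?Im1 ?ImN1 ltxx.
Qed.

Section Positivity.
Variables (n d : nat) (z w : algC).
Hypothesis (z0 : z != 0) (zV : z^-1 = z^*).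
Hypothesis z_pos : forall a, (0 < a < n)%N -> 0 < 'Im (z ^+ a).
Hypothesis wn : w ^+ n = 1.
Hypothesis wd : w ^+ d = z ^+ 2.

Let S e : algC := 'Im (z ^+ e).

Lemma one_sub_sqr e : 1 - (z ^+ 2) ^+ e = - (2 * 'i * S e) * z ^+ e.
Proof.
have ze0 : z ^+ e != 0 by rewrite expf_neq0.
have cE : (z ^+ e)^* = (z ^+ e)^-1 by rewrite rmorphXn /= -zV exprVn.
have -> : 2 * 'i * S e = z ^+ e - (z ^+ e)^-1.
  rewrite /S ImE cE; have := sqrCi algC; set j := 'i => j2.
  transitivity (j ^+ 2 * ((z ^+ e)^-1 - z ^+ e)); last by rewrite j2; ring.
  by field.
by rewrite -exprM mulnC exprM; field.
Qed.

Lemma pair_eq0 a a' m k : (a + d * m = n * a')%N -> (m < k)%N -> pair d a k w = 0.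
Proof.
move=> aE mk; rewrite /pair /qpoch (bigD1 (Ordinal mk)) //=.
by rewrite -exprM -exprD aE exprM wn expr1n subrr !mul0r.
Qed.

(** [S e] plays the role of sin(pi e / n). Successive G have quotient S (m - k) S (k + m + 1) / S (k
    + 1)^2, and for k < m these arguments lie strictly between 0 and n because 2m < n. For k > m a
    factor of [pair] vanishes. *)
Lemma pair_nonneg_half a a' m k : (0 < a < d)%N -> (a + d * m = n * a')%N ->
  (m.*2 < n)%N -> (k < n)%N -> exists2 G, 0 <= G & pair d a k w = (- z^-1) ^+ k * G.
Proof.
move=> a0d aE mn kn; have [mk|km] := ltnP m k.
  by exists 0 => //; rewrite (pair_eq0 aE mk) mulr0.
elim: k km kn => [|k IH] km kn.
  by exists 1; rewrite ?ler01 // /pair /qpoch !big_ord0 !(expr0, expr1n, invr1, mulr1).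
have [G G0 GE] := IH (ltnW km) (ltnW kn).
have e1 : 1 - w ^+ (a + d * k) = 2 * 'i * S (m - k) / z ^+ (m - k).
  have h : w ^+ (a + d * k) * (z ^+ 2) ^+ (m - k) = 1.
    rewrite -wd -exprM -exprD.
    have -> : (a + d * k + d * (m - k) = n * a')%N by move: km aE; nia.
    by rewrite exprM wn expr1n.
  have z20 : (z ^+ 2) ^+ (m - k) != 0 by rewrite !expf_neq0.
  apply: (mulIf z20); rewrite mulrBl h mul1r -opprB one_sub_sqr.
  by rewrite -[(z ^+ 2) ^+ _]exprM mulnC exprM; field; rewrite expf_neq0.
have e2 : 1 - w ^+ (d - a + d * k) = - (2 * 'i * S (k + m).+1) * z ^+ (k + m).+1.
  rewrite -one_sub_sqr -wd -exprM; congr (1 - _).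
  have -> : (d * (k + m).+1 = (d - a + d * k) + n * a')%N by move: a0d aE; nia.
  by rewrite [RHS]exprD [w ^+ (n * _)]exprM wn expr1n mulr1.
have e3 : 1 - w ^+ (d + d * k) = - (2 * 'i * S k.+1) * z ^+ k.+1.
  by rewrite -mulnS exprM wd one_sub_sqr.
have S0 i : (0 < i < n)%N -> S i != 0 by move=> /z_pos; rewrite lt_def => /andP[].
have k0 := S0 k.+1 kn.
exists (G * (S (m - k) * S (k + m).+1 / S k.+1 ^+ 2)).
  apply: mulr_ge0 => //; apply: divr_ge0; last first.
    by rewrite exprn_ge0 // ltW // z_pos // kn.
  by apply: mulr_ge0; apply: ltW; apply: z_pos; move: km mn; lia.
rewrite pairS GE e1 e2 e3.
have -> : z ^+ (k + m).+1 = z ^+ (m - k) * z ^+ k * z ^+ k.+1.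
  by rewrite -!exprD; congr (_ ^+ _); move: km; lia.
have := neq0Ci algC; have := sqrCi algC; set j := 'i => j2 j0.
have zmk : z ^+ (m - k) != 0 by rewrite expf_neq0.
have zk : z ^+ k != 0 by rewrite expf_neq0.
rewrite !exprS; move: (z ^+ (m - k)) (z ^+ k) zmk zk => u v u0 v0.
have two0 : (2%:R : algC) != 0 by rewrite pnatr_eq0.
by field; rewrite ?u0 ?v0 ?j0 ?z0 ?k0 ?two0.
Qed.

(** The reflection a -> d - a preserves [pair] and sends m to n - 1 - m, which covers the case 2m >=
    n. *)
Lemma pair_nonneg a a' m k : (0 < a < d)%N -> (a + d * m = n * a')%N ->
  (m < n)%N -> (k < n)%N -> exists2 G, 0 <= G & pair d a k w = (- z^-1) ^+ k * G.
Proof.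
move=> a0d aE mn kn; have [m2|m2] := ltnP m.*2 n; first exact: pair_nonneg_half aE m2 kn.
have -> : pair d a k w = pair d (d - a) k w.
  rewrite /pair; have -> : (d - (d - a) = a)%N by move: a0d; lia.
  by rewrite [X in X / _]mulrC.
apply: (@pair_nonneg_half (d - a) (d - a') (n - m.+1) k) => //.
- by move: a0d; lia.
- by rewrite mulnBr; move: a0d aE mn; nia.
- by move: m2 mn; lia.
Qed.

Lemma cpair_sum_neq0 a b a' b' m m' : (0 < n)%N ->
  (0 < a < d)%N -> (0 < b < d)%N -> (a + d * m = n * a')%N -> (b + d * m' = n * b')%N ->
  (m < n)%N -> (m' < n)%N -> \sum_(j < n) cpair d a b j w != 0.
Proof.
move=> n0 a0d b0d aE bE mn m'n.
have ge0 j : (j < n)%N -> 0 <= cpair d a b j w.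
  move=> jn; have [G G0 GE] := pair_nonneg a0d aE mn jn.
  have [G' G'0 G'E] := pair_nonneg b0d bE m'n jn.
  rewrite /cpair GE G'E wd.
  (* The phases of the two pairs cancel against w^(d j) = z^(2j). *)
  have -> : (- z^-1) ^+ j * G * ((- z^-1) ^+ j * G') * (z ^+ 2) ^+ j = G * G'.
    transitivity (((- z^-1) ^+ 2 * z ^+ 2) ^+ j * (G * G')).
      by rewrite [in RHS]exprMn -[((- z^-1) ^+ 2) ^+ j]exprM mul2n -addnn exprD; ring.
    by rewrite sqrrN -exprMn mulVf // !expr1n mul1r.
  exact: mulr_ge0.
rewrite (bigD1 (Ordinal n0)) //= gt_eqF // ltr_wpDr //.
  by apply: sumr_ge0 => i _; apply: ge0.
by rewrite /cpair /pair /qpoch !big_ord0 !(expr0, expr1n, invr1, mulr1) ltr01.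
Qed.

End Positivity.

(** * Admissible parameters *)

(* Multiplication by a unit modulo d permutes the multiset {a, d-a, b, d-b}. *)
Definition unit_stable (d a b : nat) : bool :=
  all (fun u => coprime u d ==>
    has (fun a' => has (fun b' =>
      [&& (u * a') %% d == a, (u * b') %% d == b &
          ((a' \in [:: a; d - a]) && (b' \in [:: b; d - b]))
          || ((a' \in [:: b; d - b]) && (b' \in [:: a; d - a]))]%N)
      (iota 1 d.-1)) (iota 1 d.-1)) (iota 0 d).

Lemma admissible_stable r1 r2 (d := lcd r1 r2) : admissible r1 r2 ->
  [/\ (0 < natmulq d r1 < d)%N, (0 < natmulq d r2 < d)%N &
      unit_stable d (natmulq d r1) (natmulq d r2)].
Proof.
rewrite /d /admissible => /orP[/andP[]|]; rewrite !inE.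
  by do 2![move=> /or4P[] /eqP ->]; vm_compute.
by move=> /or4P[] /eqP[-> ->]; vm_compute.
Qed.

Lemma pairC (F : fieldType) d a k (q : F) : (a <= d)%N -> pair d (d - a) k q = pair d a k q.
Proof. by move=> ad; rewrite /pair subKn // [X in X / _]mulrC. Qed.

(** a' is a / n modulo d and m is the integer part of n a' / d, below n since a' < d. The last two
    clauses hold by symmetry under a -> d - a and under exchange of the two pairs. *)
Lemma dwork_prime d a b n : (0 < n)%N -> coprime n d -> (0 < a < d)%N -> (0 < b < d)%N ->
  unit_stable d a b -> exists a' b' m m',
  [/\ (0 < a' < d)%N /\ (0 < b' < d)%N, (m < n)%N /\ (m' < n)%N,
      (a + d * m = n * a')%N /\ (b + d * m' = n * b')%N,
      (a' * (d - a') + b' * (d - b') = a * (d - a) + b * (d - b))%N &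
      forall (F : fieldType) k (q : F), cpair d a' b' k q = cpair d a b k q].
Proof.
move=> n0 nd a0d b0d /allP st.
have d0 : (0 < d)%N by move: a0d; lia.
have da : (a <= d)%N by move: a0d; lia.
have db : (b <= d)%N by move: b0d; lia.
have := st (n %% d)%N; rewrite mem_iota ltn_pmod // => /(_ isT).
rewrite coprime_modl nd /= => /hasP[a' a'I /hasP[b' b'I]].
rewrite !modnMml => /and3P[/eqP na /eqP nb perm].
move: a'I b'I; rewrite !mem_iota => a'I b'I.
have a'0d : (0 < a' < d)%N by move: a'I d0; lia.
have b'0d : (0 < b' < d)%N by move: b'I d0; lia.
exists a', b', ((n * a') %/ d)%N, ((n * b') %/ d)%N; split=> //.
- by rewrite !ltn_divLR // !ltn_pmul2l //; move: a'0d b'0d; lia.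
- by split; rewrite addnC mulnC; [rewrite -[X in (_ + X)%N]na|rewrite -[X in (_ + X)%N]nb]; rewrite -divn_eq.
- have sym x : (x <= d)%N -> ((d - x) * (d - (d - x)) = x * (d - x))%N.
    by move=> xd; rewrite subKn // mulnC.
  move: perm; rewrite !inE => /orP[]/andP[]/orP[]/eqP-> /orP[]/eqP->;
  by rewrite ?sym // addnC.
move=> F k q; move: perm; rewrite !inE.
move=> /orP[]/andP[]/orP[]/eqP-> /orP[]/eqP->;
  by rewrite /cpair ?pairC // [X in X * _]mulrC.
Qed.

Section Coefficients.
Variables (r1 r2 : rat).
Hypothesis hr : admissible r1 r2.
Let d := lcd r1 r2.

Let natmulqC r : (0 <= r <= 1) -> (`|denq r| %| d)%N ->
  natmulq d (1 - r) = (d - natmulq d r)%N /\ (natmulq d r)%:R = d%:R * r :> rat.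
Proof.
move=> r01 dr; have r0 : 0 <= r by case/andP: r01.
have E := natmulqE r0 dr; split=> //; have E1 := natmulq1BE r01 dr.
apply/eqP; rewrite -(eqr_nat rat) natrB; first by rewrite E1 E mulrBr mulr1.
by rewrite -(ler_nat rat) E ler_piMr ?ler0n //; case/andP: r01.
Qed.

Let a := natmulq d r1.
Let b := natmulq d r2.

Lemma natmulq_facts :
  [/\ natmulq d (1 - r1) = (d - a)%N, natmulq d (1 - r2) = (d - b)%N,
      a%:R = d%:R * r1 :> rat & b%:R = d%:R * r2 :> rat].
Proof.
have [r1I r2I] := admissible_itv hr.
have [] := natmulqC r1I (dvdn_lcml _ _); have [] := natmulqC r2I (dvdn_lcmr _ _).
by split.
Qed.

Lemma c_cpair (F : fieldType) k (x : F) : c r1 r2 k x = cpair d a b k x.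
Proof.
have [e1 e2 _ _] := natmulq_facts.
rewrite /c -/d -/a -/b e1 e2 /cpair /pair exprM.
set D := qpoch (x ^+ d) _ _; have -> : D ^- 4 = D ^- 2 * D ^- 2 by rewrite -invfM -exprD.
ring.
Qed.

Let ad : (0 < a < d)%N. Proof. by have [] := admissible_stable hr. Qed.
Let bd : (0 < b < d)%N. Proof. by have [_ []] := admissible_stable hr. Qed.
Let d0 : (d%:R : rat) != 0. Proof. by rewrite pnatr_eq0; move: ad; lia. Qed.

Lemma mu_nat : d%:R ^+ 2 * mu r1 r2 = (a * (d - a) + b * (d - b))%:R.
Proof.
have [_ _ e1 e2] := natmulq_facts.
have da : (a <= d)%N by move: ad; lia.
have db : (b <= d)%N by move: bd; lia.
rewrite natrD !natrM !natrB // e1 e2 /mu; ring.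
Qed.

Lemma c1S k : c1 r1 r2 k.+1 = c1 r1 r2 k *
  ((a + d * k)%:R * (d - a + d * k)%:R * ((b + d * k)%:R * (d - b + d * k)%:R)
   / (d + d * k)%:R ^+ 4).
Proof.
have [_ _ e1 e2] := natmulq_facts.
have da : (a <= d)%N by move: ad; lia.
have db : (b <= d)%N by move: bd; lia.
have pochS r : poch r k.+1 = poch r k * (r + k%:R) by rewrite /poch big_ord_recr.
have f0 : (k`!%:R : rat) != 0 by rewrite pnatr_eq0 -lt0n fact_gt0.
have k0 : (1 + k%:R : rat) != 0 by rewrite addrC natr1 pnatr_eq0.
have fS : k.+1`!%:R = (1 + k%:R) * k`!%:R :> rat by rewrite factS natrM -natr1 [k%:R + 1]addrC.
rewrite /c1 !pochS fS !natrD !natrM !natrB // e1 e2.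
move: (d%:R) d0 (k%:R) k0 (k`!%:R) f0 => D D0 K K0 f f0.
have DK : D + D * K != 0 by rewrite -{1}[D]mulr1 -mulrDr mulf_neq0.
by field; rewrite DK f0 K0.
Qed.

Lemma H1_gt0 N : (0 < N)%N -> 0 < H1 r1 r2 N.
Proof.
have ge0 k : 0 <= c1 r1 r2 k.
  elim: k => [|k IH]; first by rewrite /c1 /poch !big_ord0.
  by rewrite c1S mulr_ge0 // divr_ge0 ?exprn_ge0 ?mulr_ge0.
case: N => // N _; rewrite /H1 big_ord_recl ltr_wpDr //; first by apply: sumr_ge0 => i _.
by rewrite /c1 /poch !big_ord0.
Qed.

Section Values.
Variables (F : fieldType) (I : adic F) (emb : {rmorphism rat -> F}) (y : F).
Hypothesis nat_unit : forall k, (0 < k)%N -> iunit I k%:R.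
Hypothesis y1 : I 1%N (y - 1).
Hypothesis y_neq1 : y != 1.

Lemma qn_near k : I 1%N (qn k y - k%:R).
Proof.
have -> : k%:R = \sum_(i < k) (1 : F) by rewrite sumr_const card_ord.
apply: adicBsum => i _; rewrite -[X in _ - X](expr1n _ i); apply: adicBX => //.
by case: (iunit_close (iunit1 I) y1).
Qed.

(** The quotients in c become 0 / 0 at y = 1. In the ratio f of consecutive terms the powers of 1 -
    y cancel, leaving factors [j]_y close to j, as in [c1S]. *)
Lemma c_near k : I 1%N (c r1 r2 k y - emb (c1 r1 r2 k)) /\ I 0%N (c r1 r2 k y).
Proof.
have near0 v r : I 1%N (v - r) -> I 0%N r -> I 0%N v.
  by move=> vr r0; rewrite -(subrK r v); apply: adicD => //; exact: adicW.
have q0 j : I 0%N (qn j y) := near0 _ _ (qn_near j) (adic_nat _ _).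
have d1 : (0 < d)%N by move: ad; lia.
elim: k => [|k [IH IH0]].
  rewrite c_cpair /cpair /pair /c1 /qpoch /poch !big_ord0 fact0 !(expr0, expr1n, invr1, mulr1).
  by rewrite rmorph1 subrr; split; [exact: adic0|exact: adic1].
have yu := iunit_close (iunit1 I) y1.
pose f := qn (a + d * k) y * qn (d - a + d * k) y * (qn (b + d * k) y * qn (d - b + d * k) y)
  / qn (d + d * k) y ^+ 4 * y ^+ d.
have dk : (0 < d + d * k)%N by rewrite addn_gt0 d1.
have Du : iunit I (qn (d + d * k) y ^+ 4).
  by apply: iunitX; apply: iunit_close (nat_unit dk) (qn_near _).
have cS : c r1 r2 k.+1 y = c r1 r2 k y * f.
  have qd0 : qn (d + d * k) y != 0.
    by apply: contraNneq (iunit_neq0 Du) => ->; rewrite expr0n.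
  have y1' : 1 - y != 0 by rewrite subr_eq0 eq_sym.
  have eX : (y ^+ d) ^+ k.+1 = (y ^+ d) ^+ k * y ^+ d by rewrite exprSr.
  rewrite !c_cpair /cpair !pairS eX -!qnE /f.
  move: (pair d a k y) (pair d b k y) ((y ^+ d) ^+ k) (y ^+ d) => p1 p2 Y Yd.
  move: (qn (d + d * k) y) (1 - y) qd0 y1' => D e D0 e0.
  move: (qn _ y) (qn _ y) (qn _ y) (qn _ y) => u1 u2 u3 u4.
  by field; rewrite D0 e0.
have fI0 : I 0%N f.
  apply: adicMl; last by apply: adicX; case: yu.
  by apply: adicMl; [do ?[apply: adicMl]|exact: adic0V].
rewrite cS; split; last exact: adicMl.
rewrite c1S rmorphM /=; apply: adicBM => //.
  by apply: near0 (adicBC IH) IH0.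
rewrite fmorph_div !(rmorphM, rmorphXn, rmorph_nat) /= -[X in _ - X]mulr1.
have nu : iunit I ((d + d * k)%:R ^+ 4) by apply: iunitX; exact: nat_unit.
have N j := adic_nat I j.
apply: adicBM.
- by apply: adicMl; [do ?[apply: adicMl]|exact: adic0V].
- by apply: adicX; case: yu.
- apply: adicBM.
  + by do ?[apply: adicMl].
  + exact: adic0V.
  + apply: adicBM; [exact: adicMl| exact: adicMl | |]; apply: adicBM => //; exact: qn_near.
  + by apply: adicBV => //; apply: adicBX => //; exact: qn_near.
- by rewrite -[X in _ - X](expr1n _ d); apply: adicBX => //; case: yu.
Qed.

End Values.
End Coefficients.

(** * The quotient of truncated sums *)

Lemma sum_block (R : nmodType) (f : nat -> R) (n l : nat) :
  \sum_(i < l * n) f i = \sum_(k < l) \sum_(s < n) f (k * n + s)%N.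
Proof.
elim: l => [|l IH]; first by rewrite !big_ord0.
by rewrite mulSnr big_split_ord /= IH big_ord_recr.
Qed.

Section Ratio.
Variables (r1 r2 : rat).
Hypothesis hr : admissible r1 r2.
Let d := lcd r1 r2.
Let a := natmulq d r1.
Let b := natmulq d r2.
Variables (F : fieldType) (I : adic F) (emb : {rmorphism rat -> F}).
Variables (n : nat) (q z : F).
Hypothesis emb_unit : forall r, r != 0 -> iunit I (emb r).
Hypothesis n1 : (0 < n)%N.
Hypothesis zprim : n.-primitive_root z.
Hypothesis zI : I 0%N z.
Hypothesis qz : I 1%N (q - z).
Hypothesis q_inj : forall i j, q ^+ i = q ^+ j -> i = j.
Hypothesis nd : coprime n d.
Let S0 := \sum_(j < n) c r1 r2 j q.
Hypothesis S0_unit : iunit I S0.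
Let y := q ^+ n.
Let t := y - 1.
Let kappa := nu F n * t ^+ 2 * d%:R ^+ 2.

Let emb_I r : I 0%N (emb r).
Proof.
by have [->|/emb_unit[]//] := eqVneq r 0; rewrite rmorph0; exact: adic0.
Qed.
Let nat_unit k : (0 < k)%N -> iunit I k%:R.
Proof. by move=> k0; rewrite -(rmorph_nat emb); apply: emb_unit; rewrite pnatr_eq0 -lt0n. Qed.
Let t1 : I 1%N t.
Proof.
rewrite /t -(prim_expr_order zprim); apply: adicBX => //.
by case: (iunit_close (prim_unit zprim zI) qz).
Qed.
Let y_neq1 : y != 1.
Proof. by rewrite /y -(expr0 q); apply/eqP => /q_inj; move: n1; lia. Qed.
Let cn k := c_near hr emb nat_unit t1 y_neq1 k.
Let t2 : I 2%N (nu F n * t ^+ 2).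
Proof. by apply: adicMl; [exact: nuI|exact: adicXn]. Qed.
Let kappa2 : I 2%N kappa.
Proof. by apply: adicMr => //; apply: adicX; exact: adic_nat. Qed.

(** Since kappa has order 2, c(l;q^n) may be replaced by its value at 1 in the correction term. *)
Lemma c_block_congr l : I 3%N (\sum_(j < n) c r1 r2 (l * n + j) q
  - S0 * (c r1 r2 l y - kappa * emb (l%:R * (l%:R + mu r1 r2) * c1 r1 r2 l))).
Proof.
have [ad bd st] := admissible_stable hr; rewrite -/d -/a -/b in ad bd st.
have [a' [b' [m [m' [[a'0d b'0d] [mn m'n] [aE bE] perm cE]]]]] := dwork_prime n1 nd ad bd st.
have [cl cl0] := cn l.
have S0E : S0 = \sum_(j < n) cpair d a b j q by apply: eq_bigr => j _; rewrite c_cpair.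
have sE : \sum_(j < n) c r1 r2 (l * n + j) q = \sum_(j < n) cpair d a b (l * n + j) q.
  by apply: eq_bigr => j _; rewrite c_cpair.
have clE : c r1 r2 l y = cpair d a' b' l y by rewrite cE c_cpair.
have := cpair_congr nat_unit zprim zI qz q_inj nd ad bd a'0d b'0d mn m'n aE bE (l := l).
rewrite -/y -clE => /(_ cl0); rewrite perm sE -S0E -/t => h.
apply: (adicB_trans h); rewrite -mulrBr; apply: adicMl; first by case: S0_unit.
have M : ((d * l) ^ 2 + l * (a * (d - a) + b * (d - b)))%:R =
    d%:R ^+ 2 * emb (l%:R * (l%:R + mu r1 r2)).
  rewrite -(rmorph_nat emb) -(rmorph_nat emb d) -rmorphXn -rmorphM; congr (emb _).
  rewrite natrD natrX [(l * _)%:R]natrM -(mu_nat hr) natrM -/d; ring.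
rewrite M [emb (_ * c1 _ _ _)]rmorphM.
have -> : c r1 r2 l y * (1 - nu F n * t ^+ 2 * (d%:R ^+ 2 * emb (l%:R * (l%:R + mu r1 r2))))
   - (c r1 r2 l y - kappa * (emb (l%:R * (l%:R + mu r1 r2)) * emb (c1 r1 r2 l)))
   = - (kappa * emb (l%:R * (l%:R + mu r1 r2))) * (c r1 r2 l y - emb (c1 r1 r2 l)).
  by rewrite /kappa; ring.
apply: (adicM (k := 2%N)) => //; apply: adicN; exact: adicMr.
Qed.

Lemma H_congr N : I 3%N (H r1 r2 (N * n) q - S0 * (H r1 r2 N y - kappa * emb (W1 r1 r2 N))).
Proof.
rewrite /H (sum_block (fun k => c r1 r2 k q)) /W1 rmorph_sum /= mulr_sumr -sumrB mulr_sumr.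
by apply: adicBsum => l _; exact: c_block_congr.
Qed.

Lemma H_near N : I 1%N (H r1 r2 N y - emb (H1 r1 r2 N)) /\ I 0%N (H r1 r2 N y).
Proof.
split; last by apply: adic_sum => k _; case: (cn k).
by rewrite /H /H1 rmorph_sum; apply: adicBsum => k _; case: (cn k).
Qed.

Lemma H_ratio_congr A B : (0 < B)%N ->
  I 3%N (H r1 r2 (A * n) q / H r1 r2 (B * n) q
    - (H r1 r2 A y / H r1 r2 B y + emb (C r1 r2 A B) * (n%:R ^+ 2 - 1) * t ^+ 2)).
Proof.
move=> B0; have [hA hA0] := H_near A; have [hB hB0] := H_near B.
have HB := H_congr B; have HA := H_congr A.
have h1B : H1 r1 r2 B != 0 by rewrite gt_eqF ?H1_gt0.
have Bu : iunit I (H r1 r2 B y) by apply: iunit_close (emb_unit h1B) hB.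
have kW N : I 2%N (kappa * emb (W1 r1 r2 N)) by apply: adicMr.
set u := H r1 r2 B y - kappa * emb (W1 r1 r2 B) in HB.
set v := H r1 r2 A y - kappa * emb (W1 r1 r2 A) in HA.
have uu : iunit I u.
  by apply: iunit_close Bu _; rewrite /u addrAC subrr add0r; apply: adicN; apply: adicW.
have Su : iunit I (S0 * u) by apply: iunitM.
have HBu : iunit I (H r1 r2 (B * n) q).
  by apply: iunit_close Su _; apply: (adicWn (k := 3%N)).
have v0 : I 0%N v by apply: adicB => //; apply: (adicWn (k := 2%N)).
have Sv : I 0%N (S0 * v) by apply: adicMl => //; case: S0_unit.
have HA0 : I 0%N (H r1 r2 (A * n) q).
  rewrite -(subrK (S0 * v) (H _ _ _ q)); apply: adicD => //.
  exact: (adicWn (k := 3%N)).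
apply: (adicB_trans (g := S0 * v / (S0 * u))).
  by apply: adicBM => //; [exact: adic0V|exact: adicBV].
rewrite -mulf_div divff ?(iunit_neq0 S0_unit) // mul1r.
clear HA HB HBu Su Sv HA0; set X := H r1 r2 A y in hA hA0 v v0 *; set Y := H r1 r2 B y in hB hB0 u uu Bu *.
set w := emb (W1 r1 r2 B) in u uu *; set w' := emb (W1 r1 r2 A) in v v0 *.
set x := emb (H1 r1 r2 A) in hA; set y' := emb (H1 r1 r2 B) in hB.
have yu : iunit I y' := emb_unit h1B.
have CE : emb (C r1 r2 A B) * (n%:R ^+ 2 - 1) * t ^+ 2 = kappa * ((x * w - y' * w') / y' ^+ 2).
  rewrite /C fmorph_div !(rmorphM, rmorphB, rmorphXn, rmorph_nat) /= -/d -/x -/y' -/w -/w' /kappa /nu.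
  have t12 : (12%:R : F) != 0 by apply: iunit_neq0 (nat_unit _).
  move: (iunit_neq0 yu) t12; move: (12%:R) => T y0 T0.
  by field; rewrite y0 T0.
rewrite CE.
have Y0 := iunit_neq0 Bu; have u0 := iunit_neq0 uu.
(* An exact identity. The first term on the right has order 2 + 1, as X and Y are close to x and y';
   the second has order 4. *)
have -> : v / u - (X / Y + kappa * ((x * w - y' * w') / y' ^+ 2)) =
  kappa * (((X * w - Y * w') / Y ^+ 2) - ((x * w - y' * w') / y' ^+ 2))
  + kappa * kappa * (w * (X * w - Y * w') / (u * Y ^+ 2)).
  have y0 := iunit_neq0 yu; move: u0; rewrite /u /v => u0.
  by field; rewrite u0 Y0 y0.
have w0 : I 0%N w := emb_I _.
have w'0 : I 0%N w' := emb_I _.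
have x0 : I 0%N x := emb_I _; have y'0 : I 0%N y' := emb_I _.
have num0 : I 0%N (X * w - Y * w') by apply: adicB; apply: adicMl.
apply: adicD; last first.
  apply: adicMr; first by apply: (adicWn (k := (2 + 2)%N)) => //; apply: adicM.
  apply: adicMl; first exact: adicMl.
  by apply: adic0V; apply: iunitM => //; apply: iunitX.
apply: (adicM (k := 2%N)) => //; apply: adicBM => //.
- by apply: adicB; apply: adicMl.
- by apply: adic0V; apply: iunitX.
- have -> : X * w - Y * w' - (x * w - y' * w') = (X - x) * w - (Y - y') * w' by ring.
  by apply: adicB; apply: adicMr.
- by apply: adicBV; [exact: iunitX|exact: iunitX|exact: adicBX].
Qed.

End Ratio.

(** * Transfer between Z(q) and algC(q), and the theorem *)

Lemma intrp_eq0 (p : {poly int}) : (intrp p == 0) = (p == 0).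
Proof.
apply/eqP/eqP => [p0|->]; last by rewrite rmorph0.
by apply: (map_inj_poly (intr_inj : injective (intr : int -> algC))); rewrite ?rmorph0.
Qed.

Lemma relatedD f g f' g' : related f f' -> related g g' -> related (f + g) (f' + g').
Proof.
move=> [a [b [b0 -> ->]]] [a' [b' [b'0 -> ->]]]; exists (a * b' + a' * b), (b * b').
rewrite mulf_neq0 // !addf_div ?tofrac_eq0 ?intrp_eq0 //.
by rewrite !(rmorphD, rmorphM).
Qed.

Lemma relatedM f g f' g' : related f f' -> related g g' -> related (f * g) (f' * g').
Proof.
move=> [a [b [b0 -> ->]]] [a' [b' [b'0 -> ->]]]; exists (a * a'), (b * b').
by rewrite mulf_neq0 // !mulf_div !rmorphM.
Qed.

Lemma related_poly (p : {poly int}) : related p%:F (fracp (intrp p)).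
Proof. by exists p, 1; rewrite oner_eq0 !rmorph1 !divr1. Qed.

Lemma related0 : related 0 0.
Proof. by have := related_poly 0; rewrite !rmorph0. Qed.

Lemma related1 : related 1 1.
Proof. by have := related_poly 1; rewrite !rmorph1. Qed.

Lemma relatedN f f' : related f f' -> related (- f) (- f').
Proof.
move=> [a [b [b0 -> ->]]]; exists (- a), b; rewrite b0; split=> //.
  by rewrite rmorphN mulNr.
by rewrite !rmorphN mulNr.
Qed.

Lemma relatedV f f' : related f f' -> related f^-1 f'^-1.
Proof.
move=> [a [b [b0 -> ->]]]; have [->|a0] := eqVneq a 0.
  by rewrite !rmorph0 !mul0r !invr0; exact: related0.
by exists b, a; rewrite a0 !invf_div.
Qed.

Lemma relatedX f f' k : related f f' -> related (f ^+ k) (f' ^+ k).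
Proof.
by move=> h; elim: k => [|k IH]; rewrite ?exprS; [exact: related1|exact: relatedM].
Qed.

Lemma related_sum (T : Type) (r : seq T) (f : T -> ratfun) f' :
  (forall i, related (f i) (f' i)) -> related (\sum_(i <- r) f i) (\sum_(i <- r) f' i).
Proof.
move=> h; elim: r => [|i r IH]; first by rewrite !big_nil; exact: related0.
by rewrite !big_cons; apply: relatedD.
Qed.

Lemma related_prod (T : Type) (r : seq T) (f : T -> ratfun) f' :
  (forall i, related (f i) (f' i)) -> related (\prod_(i <- r) f i) (\prod_(i <- r) f' i).
Proof.
move=> h; elim: r => [|i r IH]; first by rewrite !big_nil; exact: related1.
by rewrite !big_cons; apply: relatedM.
Qed.

Lemma related_qpoch a a' x x' k : related a a' -> related x x' ->
  related (qpoch a x k) (qpoch a' x' k).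
Proof.
move=> ha hx; apply: related_prod => i; apply: relatedD; first exact: related1.
by apply: relatedN; apply: relatedM => //; apply: relatedX.
Qed.

Lemma related_H r1 r2 N x x' : related x x' -> related (H r1 r2 N x) (H r1 r2 N x').
Proof.
move=> hx; apply: related_sum => k.
have hq m d : related (qpoch (x ^+ m) (x ^+ d) k) (qpoch (x' ^+ m) (x' ^+ d) k).
  by apply: related_qpoch; apply: relatedX.
apply: relatedM; last exact: relatedX.
apply: relatedM; last by apply: relatedV; apply: relatedX.
by do ?apply: relatedM.
Qed.

Definition emb : {rmorphism rat -> {fraction {poly algC}}} :=
  (@FracField.tofrac {poly algC} \o (polyC \o (ratr : rat -> algC)))%FUN.

Lemma related_ratr r : related (ratr r) (emb r).
Proof.
have E (x : int) : x%:P = x%:~R :> {poly int} by rewrite -{1}[x]intz rmorph_int.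
exists (numq r)%:~R, (denq r)%:~R; split.
- by rewrite -E polyC_eq0 denq_neq0.
- by rewrite /ratr !rmorph_int.
by rewrite !rmorph_int -[in LHS](divq_num_den r) fmorph_div !rmorph_int.
Qed.

Lemma iunit_nonzero_const (z u : algC) : u != 0 -> iunit (localization z) (fracp u%:P).
Proof. by move=> u0; apply: localization_unit; rewrite hornerC. Qed.

Lemma cpair_const d a b k (u : algC) :
  cpair d a b k (fracp u%:P) = fracp (cpair d a b k u)%:P.
Proof.
pose phi : {rmorphism algC -> {fraction {poly algC}}} :=
  (@FracField.tofrac {poly algC} \o polyC)%FUN.
rewrite -[fracp u%:P]/(phi u) -[RHS]/(phi _).
have qE e x j : qpoch (phi u ^+ e) (phi u ^+ x) j = phi (qpoch (u ^+ e) (u ^+ x) j).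
  rewrite /qpoch rmorph_prod; apply: eq_bigr => i _.
  by rewrite rmorphB rmorph1 rmorphM !rmorphXn.
by rewrite /cpair /pair !qE !(rmorphM, fmorphV, rmorphXn).
Qed.

Lemma qvar_exp_inj i j : fracp ('X : {poly algC}) ^+ i = fracp 'X ^+ j -> i = j.
Proof.
rewrite -!tofracXn => /eqP; rewrite tofrac_eq => /eqP /(congr1 (fun p : {poly algC} => size p)).
by rewrite !size_polyXn => - [].
Qed.

(** For j < n the denominators at z are products of factors 1 - z^(d i) with 0 < i < n, hence
    units. *)
Lemma cpair_near (F : fieldType) (I : adic F) n d a b j (q z : F) :
  (forall k, (0 < k)%N -> iunit I k%:R) -> n.-primitive_root z -> I 0%N z -> I 1%N (q - z) ->
  coprime n d -> (j < n)%N -> I 1%N (cpair d a b j q - cpair d a b j z).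
Proof.
move=> nat_unit zprim zI qz nd jn.
have zu := prim_unit zprim zI; have qu := iunit_close zu qz.
have Qprim : n.-primitive_root (z ^+ d) by rewrite prim_root_exp_coprime // coprime_sym.
have QI : I 0%N (z ^+ d) by apply: adicX.
have qX k : I 1%N (q ^+ k - z ^+ k) by apply: adicBX => //; case: qu.
have one0 : I 0%N (1 : F) := adic1 I.
have lin e i : I 1%N ((1 - q ^+ e * (q ^+ d) ^+ i) - (1 - z ^+ e * (z ^+ d) ^+ i)).
  have -> (u v : F) : 1 - u - (1 - v) = - (u - v) by ring.
  by apply: adicN; rewrite -!exprM -!exprD.
have lin0 e i (x : F) : iunit I x -> I 0%N (1 - x ^+ e * (x ^+ d) ^+ i).
  by move=> [x0 _]; apply: adicB => //; apply: adicMl; do ?apply: adicX.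
have qp e : I 1%N (qpoch (q ^+ e) (q ^+ d) j - qpoch (z ^+ e) (z ^+ d) j).
  by apply: adicBprod => i _ //; exact: lin0.
have qp0 e x : iunit I x -> I 0%N (qpoch (x ^+ e) (x ^+ d) j).
  by move=> xu; apply: adic_prod => i _; exact: lin0.
have zD : iunit I (qpoch (z ^+ d) (z ^+ d) j).
  apply: iunit_prod => i _; rewrite -exprS.
  apply: prim_unit1 Qprim QI nat_unit _ _; have := ltn_ord i; lia.
have qD : iunit I (qpoch (q ^+ d) (q ^+ d) j) by apply: iunit_close zD (qp d).
have pn e : I 1%N (pair d e j q - pair d e j z).
  apply: adicBM.
  - by apply: adicMl; apply: qp0.
  - by apply: adic0V; apply: iunitX.
  - by apply: adicBM => //; apply: qp0.
  - by apply: adicBV; [exact: iunitX|exact: iunitX|apply: adicBX => //; case: qD].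
have p0 e x : iunit I x -> iunit I (qpoch (x ^+ d) (x ^+ d) j) -> I 0%N (pair d e j x).
  move=> xu xD; apply: adicMl; first by apply: adicMl; apply: qp0.
  by apply: adic0V; apply: iunitX.
apply: adicBM.
- by apply: adicMl; apply: p0.
- by rewrite -exprM; apply: adicX; case: qu.
- by apply: adicBM => //; apply: p0.
- by rewrite -!exprM.
Qed.

Theorem mainTheorem3 (r1 r2 : rat) (hr : admissible r1 r2)
    (A B n : nat) (hA : (0 < A)%N) (hB : (0 < B)%N) (hn : (1 < n)%N)
    (hnd : coprime n (lcd r1 r2)) :
  congr_mod ('Phi_n ^+ 3)
    (H r1 r2 (A * n) qvar / H r1 r2 (B * n) qvar)
    (H r1 r2 A (qvar ^+ n) / H r1 r2 B (qvar ^+ n)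
     + ratr (C r1 r2 A B) * (n%:R ^+ 2 - 1) * (qvar ^+ n - 1) ^+ 2).
Proof.
set d := lcd r1 r2 in hnd *; have n0 : (0 < n)%N by apply: ltnW.
have [ad bd st] := admissible_stable hr; rewrite -/d in ad bd st.
have [a' [b' [m [m' [_ [mn m'n] [aE bE] _ _]]]]] := dwork_prime n0 hnd ad bd st.
have [z [z0 zV z2 z_pos]] := ex_sines hn.
(* e inverts d modulo n, so that w = z^(2e) is a primitive n-th root of unity with w^d = z^2, as
   positivity requires. The localization is taken at w. *)
have [e eE] : exists e, (d * e = 1 %[mod n])%N.
  have d0 : (0 < d)%N by move: ad; lia.
  case: (egcdnP n d0) => u v uv _; exists u.
  by rewrite mulnC uv gcdnC (eqP hnd) modnMDl.
pose w := (z ^+ 2) ^+ e.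
have wd : w ^+ d = z ^+ 2.
  rewrite -exprM mulnC; apply/eqP; rewrite -[X in _ == X]expr1.
  by rewrite (eq_prim_root_expr z2); apply/eqP.
have wprim : n.-primitive_root w.
  rewrite prim_root_exp_coprime // coprime_sym.
  have : coprime n (d * e) by rewrite -coprime_modr eE coprime_modr coprimen1.
  by rewrite coprimeMr => /andP[].
have wn : w ^+ n = 1 := prim_expr_order wprim.
pose q : {fraction {poly algC}} := fracp 'X.
pose I := localization w.
have hq : related qvar q.
  by have := related_poly 'X; rewrite map_polyX.
have nat_unit k : (0 < k)%N -> iunit I k%:R.
  move=> k0; have := @iunit_nonzero_const w k%:R; rewrite !rmorph_nat; apply.
  by rewrite pnatr_eq0 -lt0n.
have wI : I 0%N (fracp w%:P) := localization_frac w _.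
have fprim : n.-primitive_root (fracp w%:P).
  have -> : fracp w%:P = (@FracField.tofrac {poly algC} \o polyC)%FUN w by [].
  by rewrite fmorph_primitive_root.
have qw : I 1%N (q - fracp w%:P) := localization_X w.
have S0 : iunit I (\sum_(j < n) c r1 r2 j q).
  have nz := cpair_sum_neq0 z0 zV z_pos wn wd n0 ad bd aE bE mn m'n.
  apply: iunit_close (iunit_nonzero_const w nz) _.
  rewrite !rmorph_sum; apply: adicBsum => j _.
  rewrite c_cpair //= -cpair_const.
  exact: cpair_near nat_unit fprim wI qw hnd (ltn_ord j).
have emb_unit r : r != 0 -> iunit I (emb r).
  by move=> r0; apply: iunit_nonzero_const; rewrite fmorph_eq0.
have := H_ratio_congr hr emb_unit n0 fprim wI qw (@qvar_exp_inj) hnd S0 A hB.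
apply: (related_congr0 wprim).
have hqn := relatedX n hq.
have hnat k : related k%:R k%:R.
  by have := related_poly k%:R; rewrite !rmorph_nat.
apply: relatedD; first by apply: relatedM; [|apply: relatedV]; exact: related_H.
apply: relatedN; apply: relatedD.
  by apply: relatedM; [|apply: relatedV]; exact: related_H.
apply: relatedM; last by apply: relatedX; apply: relatedD => //; apply: relatedN; exact: related1.
apply: relatedM; first exact: related_ratr.
apply: relatedD; last by apply: relatedN; exact: related1.
by apply: relatedX; exact: hnat.
Qed.
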